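(* Let $K$ be a field and let $n,l\ge1$ be integers. Let $a_{n,l}$ (resp. $b_{n,l}$) be the number of semibricks over the Nakayama algebra $A_{n,l}$ (resp. $B_{n,l}$), with $a_{0,l}:=1$ and $a_{n,l}:=0$ for $n<0$, and let $c_n=\frac1{n+1}\binom{2n}{n}$ be the $n$th Catalan number. (1) $a_{n,l}=c_{n+1}$ for $n=1,2,\dots,l$, and $a_{n,l}=2a_{n-1,l}+\sum_{i=2}^{l}c_{i-1}a_{n-i,l}$ for $n\ge1$. (2) $b_{n,l}=(n+1)c_n$ for $n=1,2,\dots,l$, and $b_{n,l}=2b_{n-1,l}+\sum_{i=2}^{l}c_{i-1}b_{n-i,l}$ for $n\ge l+1$. (3) Let $\xi_1,\dots,\xi_l\in\mathbb C$ be the roots, with multiplicities, of the polynomial $F_l(X):=X^l-2X^{l-1}-\sum_{i=2}^{l}c_{i-1}X^{l-i}$. Then for all $n\ge1$, $$a_{n,l}=\sum_{\substack{t_1,\dots,t_l\in\mathbb Z_{\ge0}\\t_1+\cdots+t_l=n}}\xi_1^{t_1}\xi_2^{t_2}\cdots\xi_l^{t_l}\qquad\text{and}\qquad b_{n,l}=\xi_1^n+\xi_2^n+\cdots+\xi_l^n .$$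
   Context: $A_{n,l}$ is the path algebra over $K$ of the linear quiver $1\to2\to\cdots\to n$ modulo the ideal generated by all paths of length $l$. $B_{n,l}$ is the path algebra over $K$ of the cyclic quiver $1\to2\to\cdots\to n\to1$ (a loop if $n=1$) modulo the ideal generated by all paths of length $l$. For a finite-dimensional algebra $A$, a brick is a finite-dimensional right $A$-module whose endomorphism ring is a division algebra, and a semibrick is a set of isoclasses of bricks (the empty set allowed) with $\operatorname{Hom}_A(S_1,S_2)=0$ for all distinct members $S_1,S_2$. *)

(* Defs.v *)
From HB Require Import structures.
From mathcomp Require Import all_boot all_order all_algebra.
From mathcomp Require Import boolp classical_sets functions cardinality.
From mathcomp Require Import reals complex.
From mathcomp Require Import finmap monalg.

Set Implicit Arguments.
Unset Strict Implicit.
Unset Printing Implicit Defensive.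

Import GRing.Theory Num.Theory.
Local Open Scope ring_scope.

(* A possibly zero K-algebra: a ring together with a ring morphism from K to
   its centre.  The library's [algType K] is not used because it excludes the
   zero ring, whereas KQ / I is zero when Q is empty or I is everything. *)
Record kalgebra (K : fieldType) := KAlgebra {
  kring :> pzRingType;
  kscalar : {rmorphism K -> kring};
  kscalar_central : forall k (a : kring), kscalar k * a = a * kscalar k
}.

Record quiver := Quiver {
  vertex : finType;
  arrow : finType;
  source : arrow -> vertex;
  target : arrow -> vertex
}.

Fixpoint is_path (Q : quiver) (v : vertex Q) (s : seq (arrow Q)) : bool :=
  if s is x :: s' then (source x == v) && is_path (target x) s' else true.

(* A path is stored as its initial vertex together with its successive arrows,
   so that there is one trivial path at each vertex. *)
Definition qpath (Q : quiver) :=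
  {p : vertex Q * seq (arrow Q) | is_path p.1 p.2}.

Definition path_source (Q : quiver) (p : qpath Q) : vertex Q := (val p).1.
Definition path_arrows (Q : quiver) (p : qpath Q) : seq (arrow Q) := (val p).2.
Definition path_target (Q : quiver) (p : qpath Q) : vertex Q :=
  last (path_source p) (map (@target Q) (path_arrows p)).
Definition path_length (Q : quiver) (p : qpath Q) : nat := size (path_arrows p).

Definition trivial_path (Q : quiver) (v : vertex Q) : qpath Q :=
  exist _ (v, [::]) isT.

Lemma is_path_cat (Q : quiver) v (s t : seq (arrow Q)) :
  is_path v (s ++ t) = is_path v s && is_path (last v (map (@target Q) s)) t.
Proof. by elim: s v => //= x s IHs v; rewrite IHs andbA. Qed.

Lemma path_cat_subproof (Q : quiver) (p q : qpath Q) :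
  path_target p = path_source q ->
  is_path (path_source p) (path_arrows p ++ path_arrows q).
Proof.
move=> pq; rewrite is_path_cat -/(path_target p) pq.
by rewrite (valP p) (valP q).
Qed.

(* Paths are composed from left to right: first p, then q.  With this
   convention right modules are covariant representations of the quiver. *)
Definition path_cat (Q : quiver) (p q : qpath Q) : option (qpath Q) :=
  match path_target p =P path_source q with
  | ReflectT pq => Some (exist _ (path_source p, path_arrows p ++ path_arrows q)
                               (path_cat_subproof pq))
  | ReflectF _ => None
  end.

Lemma bilinear_assoc (K : fieldType) (P : Type) (V : lmodType K) (e : P -> V)
    (m : V -> V -> V) (b : P -> P -> V) :
  (forall u v : V -> V,
     {morph u : f g / f + g} -> (forall k f, u (k *: f) = k *: u f) ->
     {morph v : f g / f + g} -> (forall k f, v (k *: f) = k *: v f) ->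
     (forall p, u (e p) = v (e p)) -> u =1 v) ->
  left_distributive m +%R -> right_distributive m +%R ->
  (forall k f g, m (k *: f) g = k *: m f g) ->
  (forall k f g, m f (k *: g) = k *: m f g) ->
  (forall p q, m (e p) (e q) = b p q) ->
  (forall p q r, m (e p) (b q r) = m (b p q) (e r)) ->
  associative m.
Proof.
move=> lin_ext mDl mDr mZl mZr mE mA f g h.
move: f; apply: (lin_ext) => [x y|k x|x y|k x|p].
- exact: mDl.
- exact: mZl.
- by rewrite !mDl.
- by rewrite !mZl.
move: g; apply: (lin_ext) => [x y|k x|x y|k x|q].
- by rewrite mDl mDr.
- by rewrite mZl mZr.
- by rewrite mDr mDl.
- by rewrite mZr mZl.
move: h; apply: (lin_ext) => [x y|k x|x y|k x|r].
- by rewrite !mDr.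
- by rewrite !mZr.
- exact: mDr.
- exact: mZr.
by rewrite !mE mA.
Qed.

Definition path_module (K : fieldType) (Q : quiver) := {malg K[qpath Q]}.
HB.instance Definition _ (K : fieldType) (Q : quiver) :=
  GRing.Lmodule.on (path_module K Q).

HB.lock Definition path_elt (K : fieldType) (Q : quiver) (p : qpath Q) :
  path_module K Q := mkmalgU p 1.

Definition path_mul_basis (K : fieldType) (Q : quiver) (p q : qpath Q) :
    path_module K Q :=
  if path_cat p q is Some r then path_elt K r else 0.

HB.lock Definition path_mul (K : fieldType) (Q : quiver) (f g : path_module K Q) :
    path_module K Q :=
  \sum_(p <- msupp f) \sum_(q <- msupp g)
    (mcoeff p f * mcoeff q g) *: path_mul_basis K p q.

Definition path_one (K : fieldType) (Q : quiver) : path_module K Q :=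
  \sum_(v : vertex Q) path_elt K (trivial_path v).

Section PathAlgebra.
Variables (K : fieldType) (Q : quiver).
Local Notation path_module := (path_module K Q).
Local Notation path_elt := (@path_elt K Q).
Local Notation path_mul_basis := (@path_mul_basis K Q).
Local Notation path_mul := (@path_mul K Q).
Local Notation path_one := (@path_one K Q).

Implicit Types f g : path_module.

Definition path_lext (h : qpath Q -> path_module) f : path_module :=
  \sum_(p <- msupp f) mcoeff p f *: h p.

Lemma path_lextEw h f (d : {fset qpath Q}) : (msupp f `<=` d)%fset ->
  path_lext h f = \sum_(p <- d) mcoeff p f *: h p.
Proof.
move=> le_fd; rewrite /path_lext (big_fset_incl _ le_fd) //= => p _ /mcoeff_outdom ->.
by rewrite scale0r.
Qed.

Lemma path_lextD h f g : path_lext h (f + g) = path_lext h f + path_lext h g.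
Proof.
rewrite (path_lextEw h (msuppD_le f g)) (path_lextEw h (fsubsetUl _ (msupp g))).
rewrite (path_lextEw h (fsubsetUr (msupp f) _)) -big_split /=.
by apply: eq_bigr => p _; rewrite mcoeffD scalerDl.
Qed.

Lemma path_lextZ h k f : path_lext h (k *: f) = k *: path_lext h f.
Proof.
rewrite (path_lextEw h (msuppZ_le k f)) /path_lext scaler_sumr.
by apply: eq_bigr => p _; rewrite mcoeffZ scalerA.
Qed.

Lemma path_lext0 h : path_lext h 0 = 0.
Proof. by have := path_lextZ h 0 0; rewrite !scale0r. Qed.

Lemma path_lext_sum h (I : Type) (r : seq I) (F : I -> path_module) :
  path_lext h (\sum_(i <- r) F i) = \sum_(i <- r) path_lext h (F i).
Proof. exact: (big_morph (path_lext h) (path_lextD h) (path_lext0 h)). Qed.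

Lemma path_lextU h p : path_lext h (path_elt p) = h p.
Proof.
by rewrite path_elt.unlock (path_lextEw h msuppU_le) big_seq_fset1 mcoeffUU scale1r.
Qed.

Lemma path_eltE f : f = \sum_(p <- msupp f) mcoeff p f *: path_elt p.
Proof.
rewrite {1}(monalgE f); apply: eq_bigr => p _.
apply/malgP => q; rewrite path_elt.unlock [RHS]mcoeffZ [LHS]mcoeffU (mcoeffU p 1 q).
by case: (p == q); rewrite ?mulr1n ?mulr0n ?mulr1 ?mulr0.
Qed.

Lemma path_lin_ext (u v : path_module -> path_module) :
  {morph u : f g / f + g} -> (forall k f, u (k *: f) = k *: u f) ->
  {morph v : f g / f + g} -> (forall k f, v (k *: f) = k *: v f) ->
  (forall p, u (path_elt p) = v (path_elt p)) -> u =1 v.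
Proof.
move=> uD uZ vD vZ uv f.
have u0 : u 0 = 0 by have := uZ 0 0; rewrite !scale0r.
have v0 : v 0 = 0 by have := vZ 0 0; rewrite !scale0r.
rewrite (path_eltE f) (big_morph u uD u0) (big_morph v vD v0).
by apply: eq_bigr => p _; rewrite uZ vZ uv.
Qed.

Lemma path_mulE f g :
  path_mul f g = path_lext (fun p => path_lext (path_mul_basis p) g) f.
Proof.
rewrite path_mul.unlock; apply: eq_bigr => p _; rewrite scaler_sumr.
by apply: eq_bigr => q _; rewrite scalerA.
Qed.

Lemma path_mulDl : left_distributive path_mul +%R.
Proof. by move=> f g h; rewrite !path_mulE path_lextD. Qed.

Lemma path_mulZl k f g : path_mul (k *: f) g = k *: path_mul f g.
Proof. by rewrite !path_mulE path_lextZ. Qed.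

Lemma path_mulDr : right_distributive path_mul +%R.
Proof.
move=> f g h; rewrite !path_mulE /path_lext -big_split; apply: eq_bigr => p _ /=.
by rewrite -/(path_lext _ (g + h)) path_lextD scalerDr.
Qed.

Lemma path_mulZr k f g : path_mul f (k *: g) = k *: path_mul f g.
Proof.
rewrite !path_mulE /path_lext scaler_sumr; apply: eq_bigr => p _.
by rewrite -/(path_lext _ (k *: g)) path_lextZ !scalerA mulrC.
Qed.

Lemma path_mulU p q : path_mul (path_elt p) (path_elt q) = path_mul_basis p q.
Proof. by rewrite path_mulE !path_lextU. Qed.

Lemma path_mul0l g : path_mul 0 g = 0.
Proof. by rewrite path_mulE path_lext0. Qed.

Lemma path_mul0r f : path_mul f 0 = 0.
Proof. by have := path_mulZr 0 f 0; rewrite !scale0r. Qed.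

Lemma path_cat_Some (p q r : qpath Q) : path_cat p q = Some r ->
  [/\ path_source r = path_source p, path_target r = path_target q
    & path_arrows r = path_arrows p ++ path_arrows q].
Proof.
rewrite /path_cat; case: eqP => // pq [<-]; split=> //.
rewrite /path_target /path_arrows /path_source /=.
by rewrite map_cat last_cat -/(path_target p) pq.
Qed.

Lemma path_catP (p q : qpath Q) :
  if path_cat p q is Some r then
    [/\ path_target p = path_source q, path_source r = path_source p,
       path_target r = path_target q
     & path_arrows r = path_arrows p ++ path_arrows q]
  else path_target p != path_source q.
Proof.
case E: (path_cat p q) => [r|].
  have [? ? ?] := path_cat_Some E; split=> //.
  by move: E; rewrite /path_cat; case: eqP.
by move: E; rewrite /path_cat; case: eqP => // /eqP.
Qed.

Lemma path_inj (p q : qpath Q) : path_source p = path_source q ->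
  path_arrows p = path_arrows q -> p = q.
Proof.
case: p q => [[v s] vs] [[w t] wt] /= Ev Es; apply: val_inj => /=.
by congr pair.
Qed.

Lemma path_mulA : associative path_mul.
Proof.
apply: (bilinear_assoc path_lin_ext path_mulDl path_mulDr
          path_mulZl path_mulZr path_mulU) => p q r.
rewrite /path_mul_basis.
case: (path_cat p q) (path_catP p q) => [pq [tp spq tpq apq]|npq];
  case: (path_cat q r) (path_catP q r) => [qr [tq sqr tqr aqr]|nqr];
  rewrite ?path_mul0l ?path_mul0r //.
- rewrite [LHS]path_mulU [RHS]path_mulU /path_mul_basis.
  case: (path_cat p qr) (path_catP p qr) => [u [_ su _ au]|]; last by rewrite tp sqr eqxx.
  case: (path_cat pq r) (path_catP pq r) => [v [_ sv _ av]|]; last by rewrite tpq tq eqxx.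
  by congr path_elt; apply: path_inj; rewrite ?su ?sv // au av aqr apq catA.
- rewrite [RHS]path_mulU /path_mul_basis.
  case: (path_cat pq r) (path_catP pq r) => [v [tv _ _ _]|//].
  by move: nqr; rewrite -tpq tv eqxx.
- rewrite [LHS]path_mulU /path_mul_basis.
  case: (path_cat p qr) (path_catP p qr) => [u [tu _ _ _]|//].
  by move: npq; rewrite tu sqr eqxx.
Qed.

Lemma path_mul1 : left_id path_one path_mul.
Proof.
apply: path_lin_ext => // [f g|k f|p]; first exact: path_mulDr.
  exact: path_mulZr.
rewrite path_mulE path_lext_sum (bigD1 (path_source p)) //= big1 => [|v nv].
  rewrite !path_lextU addr0 /path_mul_basis.
  case: path_cat (path_catP (trivial_path (path_source p)) p) => [r [_ sr _ ar]|].
    by congr path_elt; apply: path_inj.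
  by rewrite eqxx.
rewrite !path_lextU /path_mul_basis.
case: path_cat (path_catP (trivial_path v) p) => [r [tr _ _ _]|//].
by move: nv; rewrite -tr eqxx.
Qed.

Lemma path_mulr1 : right_id path_one path_mul.
Proof.
apply: path_lin_ext => // [f g|k f|p]; first exact: path_mulDl.
  exact: path_mulZl.
rewrite path_mulE path_lextU path_lext_sum (bigD1 (path_target p)) //= big1.
  rewrite path_lextU addr0 /path_mul_basis.
  case: path_cat (path_catP p (trivial_path (path_target p))) => [r [_ sr _ ar]|].
    by congr path_elt; apply: path_inj; rewrite // ar cats0.
  by rewrite eqxx.
move=> v nv; rewrite path_lextU /path_mul_basis.
case: path_cat (path_catP p (trivial_path v)) => [r [tr _ _ _]|//].
by move: nv; rewrite tr eqxx.
Qed.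

HB.instance Definition _ := GRing.Zmodule_isPzRing.Build path_module
  path_mulA path_mul1 path_mulr1 path_mulDl path_mulDr.

Definition path_scalar (k : K) : path_module := k *: path_one.

Lemma path_scalar_is_zmod_morphism : zmod_morphism path_scalar.
Proof. by move=> j k; rewrite /path_scalar scalerBl. Qed.

Lemma path_scalar_is_monoid_morphism : monoid_morphism path_scalar.
Proof.
split=> [|j k]; first exact: scale1r.
by rewrite /path_scalar [RHS]path_mulZl path_mul1 scalerA.
Qed.

HB.instance Definition _ :=
  GRing.isZmodMorphism.Build K path_module path_scalar path_scalar_is_zmod_morphism.
HB.instance Definition _ :=
  GRing.isMonoidMorphism.Build K path_module path_scalar path_scalar_is_monoid_morphism.

Lemma path_scalar_central k f : path_scalar k * f = f * path_scalar k.
Proof.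
rewrite /path_scalar [LHS]path_mulZl [RHS]path_mulZr.
by rewrite path_mul1 path_mulr1.
Qed.

Definition path_algebra : kalgebra K := KAlgebra path_scalar_central.

End PathAlgebra.

Section QuotientAlgebra.
Variables (K : fieldType) (A : kalgebra K).
Local Open Scope classical_set_scope.
Local Open Scope quotient_scope.

Definition two_sided_ideal (I : set A) : Prop :=
  [/\ I 0, (forall x y, I x -> I y -> I (x - y)),
      (forall a x, I x -> I (a * x)) & (forall a x, I x -> I (x * a))].

Definition ideal_gen (X : set A) : set A := smallest two_sided_ideal X.

Lemma ideal_gen_ideal (X : set A) : two_sided_ideal (ideal_gen X).
Proof.
split=> [J [[]]//|x y Ix Iy J JX|a x Ix J JX|a x Ix J JX].
- by have [_ JB _ _] := JX.1; apply: JB; [apply: Ix|apply: Iy].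
- by have [_ _ JM _] := JX.1; apply: JM; apply: Ix.
- by have [_ _ _ JM] := JX.1; apply: JM; apply: Ix.
Qed.

Variable X : set A.

Definition ideal_pred : {pred A} := fun x => `[< ideal_gen X x >].

Lemma ideal_predP x : reflect (ideal_gen X x) (x \in ideal_pred).
Proof. exact: asboolP. Qed.

Lemma ideal_pred_zmod : zmod_closed ideal_pred.
Proof.
have [I0 IB _ _] := ideal_gen_ideal X.
split=> [|x y /ideal_predP Ix /ideal_predP Iy]; apply/ideal_predP => //.
exact: IB.
Qed.

HB.instance Definition _ := GRing.isZmodClosed.Build A ideal_pred ideal_pred_zmod.

(* The library's additive quotient, on which the ring structure is put below;
   the library only does this for commutative rings. *)
Definition quotient_ring := Quotient.quot ideal_pred.
HB.instance Definition _ := GRing.Zmodule.on quotient_ring.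

Definition quotient_proj (x : A) : quotient_ring := \pi_(quotient_ring) x.

Lemma quotient_projE x y : (quotient_proj x = quotient_proj y) <-> ideal_gen X (x - y).
Proof.
split=> [/eqP|Ixy]; first by rewrite -Quotient.idealrBE => /ideal_predP.
by apply/eqP; rewrite -Quotient.idealrBE; apply/ideal_predP.
Qed.

Lemma quotient_reprK (a : quotient_ring) : quotient_proj (repr a) = a.
Proof. exact: reprK. Qed.

Lemma quotient_projB : zmod_morphism quotient_proj.
Proof. exact: raddfB. Qed.

Definition quotient_one : quotient_ring := quotient_proj 1.
Definition quotient_mul (a b : quotient_ring) : quotient_ring :=
  quotient_proj (repr a * repr b).

Lemma quotient_projM x y :
  quotient_proj (x * y) = quotient_mul (quotient_proj x) (quotient_proj y).
Proof.
have [_ IB IMl IMr] := ideal_gen_ideal X; have ID u v : ideal_gen X u ->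
    ideal_gen X v -> ideal_gen X (u + v).
  move=> Iu Iv; rewrite -[v]opprK; apply: (IB) => //.
  by rewrite -sub0r; apply: (IB) => //; have [] := ideal_gen_ideal X.
apply/quotient_projE; set x' := repr _; set y' := repr _.
have Ix : ideal_gen X (x - x') by apply/quotient_projE; rewrite quotient_reprK.
have Iy : ideal_gen X (y - y') by apply/quotient_projE; rewrite quotient_reprK.
rewrite -[x * y](subrK (x * y')) -mulrBr -addrA -mulrBl.
by apply: ID; [apply: IMl|apply: IMr].
Qed.

Lemma quotient_projD : {morph quotient_proj : x y / x + y}.
Proof. exact: raddfD. Qed.

Lemma quotient_mulA : associative quotient_mul.
Proof.
move=> a b c; rewrite -[a]quotient_reprK -[b]quotient_reprK -[c]quotient_reprK.
by rewrite -!quotient_projM mulrA.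
Qed.
Lemma quotient_mul1 : left_id quotient_one quotient_mul.
Proof. by move=> a; rewrite -[a]quotient_reprK -quotient_projM mul1r. Qed.
Lemma quotient_mulr1 : right_id quotient_one quotient_mul.
Proof. by move=> a; rewrite -[a]quotient_reprK -quotient_projM mulr1. Qed.
Lemma quotient_mulDl : left_distributive quotient_mul +%R.
Proof.
move=> a b c; rewrite -[a]quotient_reprK -[b]quotient_reprK -[c]quotient_reprK.
by rewrite -quotient_projD -!quotient_projM mulrDl quotient_projD.
Qed.
Lemma quotient_mulDr : right_distributive quotient_mul +%R.
Proof.
move=> a b c; rewrite -[a]quotient_reprK -[b]quotient_reprK -[c]quotient_reprK.
by rewrite -quotient_projD -!quotient_projM mulrDr quotient_projD.
Qed.

HB.instance Definition _ :=
  GRing.Zmodule_isPzRing.Build quotient_ring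
    quotient_mulA quotient_mul1 quotient_mulr1 quotient_mulDl quotient_mulDr.

Lemma quotient_proj_is_monoid_morphism : monoid_morphism quotient_proj.
Proof. by split=> // x y; apply: quotient_projM. Qed.

HB.instance Definition _ :=
  GRing.isZmodMorphism.Build A quotient_ring quotient_proj quotient_projB.
HB.instance Definition _ :=
  GRing.isMonoidMorphism.Build A quotient_ring quotient_proj
    quotient_proj_is_monoid_morphism.

Definition quotient_scalar : {rmorphism K -> quotient_ring} :=
  quotient_proj \o @kscalar K A.

Lemma quotient_scalar_central k (a : quotient_ring) :
  quotient_scalar k * a = a * quotient_scalar k.
Proof. by rewrite -[a]quotient_reprK /= -!rmorphM kscalar_central. Qed.

Definition quotient_algebra : kalgebra K := KAlgebra quotient_scalar_central.

End QuotientAlgebra.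

Definition paths_of_length (K : fieldType) (Q : quiver) (l : nat) :
    set (path_algebra K Q) :=
  [set x | exists2 p : qpath Q, path_length p = l & x = path_elt K p]%classic.

Definition truncated_path_algebra (K : fieldType) (Q : quiver) (l : nat) :
  kalgebra K := quotient_algebra (@paths_of_length K Q l).

Lemma linear_target_subproof n (i : 'I_n.-1) : (i.+1 < n)%N.
Proof. by rewrite -ltn_predRL. Qed.

(* Vertices are numbered from 0: the n - 1 arrows are i -> i.+1. *)
Definition linear_quiver (n : nat) : quiver :=
  @Quiver 'I_n 'I_n.-1 (widen_ord (leq_pred n))
    (fun i => Ordinal (linear_target_subproof i)).

(* The n arrows are i -> i.+1 mod n; this is a loop when n = 1. *)
Definition cyclic_quiver (n : nat) : quiver :=
  @Quiver 'I_n 'I_n id (@ordS n).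

Definition nakayama_A (K : fieldType) (n l : nat) : kalgebra K :=
  truncated_path_algebra K (linear_quiver n) l.

Definition nakayama_B (K : fieldType) (n l : nat) : kalgebra K :=
  truncated_path_algebra K (cyclic_quiver n) l.

(* Finite-dimensional right A-modules, with [rmod_act v a] for v.a .  Up to
   isomorphism the underlying space of such a module is K^d for some d; fixing
   it to be K^d loses no isoclass and keeps [rmodule A] a small type, as
   [set (rmodule A)] requires (over arbitrary [vectType K] carriers it is a
   universe inconsistency). *)
Record rmodule (K : fieldType) (A : kalgebra K) := RModule {
  rmod_dim : nat;
  rmod_act : 'rV[K]_rmod_dim -> A -> 'rV[K]_rmod_dim;
  rmod_actDl : forall u v a, rmod_act (u + v) a = rmod_act u a + rmod_act v a;
  rmod_actDr : forall v a b, rmod_act v (a + b) = rmod_act v a + rmod_act v b;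
  rmod_act1 : forall v, rmod_act v 1 = v;
  rmod_actM : forall v a b, rmod_act v (a * b) = rmod_act (rmod_act v a) b;
  rmod_actZ : forall v k, rmod_act v (kscalar A k) = k *: v
}.

Definition rmod_space (K : fieldType) (A : kalgebra K) (M : rmodule A) :
  vectType K := 'rV[K]_(rmod_dim M).
Coercion rmod_space : rmodule >-> Vector.type.

Section Semibricks.
Variables (K : fieldType) (A : kalgebra K).
Implicit Types M N : rmodule A.
Local Open Scope classical_set_scope.

Definition is_rhom M N (f : 'Hom(M, N)) : Prop :=
  forall v a, f (rmod_act v a) = rmod_act (f v) a.

Definition rmod_iso M N : Prop :=
  exists (f : 'Hom(M, N)) (g : 'Hom(N, M)),
    [/\ is_rhom f, is_rhom g, cancel f g & cancel g f].

(* The endomorphism ring is a division algebra: it is nonzero and every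
   nonzero element of it has a two-sided inverse in it. *)
Definition brick M : Prop :=
  (\1%VF : 'End(M)) <> 0 /\
  forall f : 'End(M), is_rhom f -> f <> 0 ->
    exists g : 'End(M), [/\ is_rhom g, (f \o g)%VF = \1%VF & (g \o f)%VF = \1%VF].

Definition isoclass M : set (rmodule A) := [set N | rmod_iso M N].

Definition semibrick (S : set (set (rmodule A))) : Prop :=
  (forall C, S C -> exists2 M, brick M & C = isoclass M) /\
  (forall C1 C2, S C1 -> S C2 -> C1 <> C2 ->
     forall M1 M2, C1 M1 -> C2 M2 ->
     forall f : 'Hom(M1, M2), is_rhom f -> f = 0).

(* [fset_set] is the empty set on infinite sets, so this is the number of
   semibricks only when there are finitely many. *)
Definition num_semibricks : nat := #|` fset_set [set S | semibrick S] |.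

End Semibricks.

(* The division is exact. *)
Definition catalan (n : nat) : nat := 'C(n.*2, n) %/ n.+1.

Definition num_A (K : fieldType) (l : nat) (n : int) : nat :=
  match n with
  | Posz 0 => 1%N
  | Posz n => num_semibricks (nakayama_A K n l)
  | Negz _ => 0%N
  end.

Definition num_B (K : fieldType) (l : nat) (n : nat) : nat :=
  num_semibricks (nakayama_B K n l).

Definition char_poly_F (L : nzRingType) (l : nat) : {poly L} :=
  'X^l - 2%:R *: 'X^(l - 1)
    - \sum_(2 <= i < l.+1) (catalan (i - 1))%:R *: 'X^(l - i).

(* Main.v *)
From HB Require Import structures.
Require Import Defs.
From mathcomp Require Import all_boot all_order all_algebra.
From mathcomp Require Import zify ring.
From mathcomp Require Import boolp classical_sets cardinality.
From mathcomp Require Import reals complex.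
From mathcomp Require Import finmap monalg.

(** Every vertex of the linear and of the cyclic quiver has at most one outgoing
    arrow, so a module over the truncated algebra is a graded space with one
    nilpotent shift T.  In a brick M let m be least with T^m = 0.  A vector v
    at a vertex with T^(m-1) v <> 0 yields maps f from the uniserial module of
    length m to M and g back with g f = 1; the endomorphism f g is nonzero, hence
    invertible, and M is that uniserial module.  Moreover m <= n because T^n is a
    nilpotent endomorphism.  So bricks are arcs (i, m), and semibricks are sets
    of arcs that are pairwise disjoint or strictly nested at both ends.
    Cutting along the longest arc covering vertex 0, of length m, leaves m - 2
    linear positions inside it and n - m outside; with Segner's recurrence this
    gives both recurrences.  Finally, with D = prod (1 - xi_j X), the a_n are
    the coefficients of 1 / D and the b_n those of - X D' / D. *)

Set Implicit Arguments.
Unset Strict Implicit.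
Unset Printing Implicit Defensive.

Import GRing.Theory Num.Theory.
Local Open Scope ring_scope.

(** Both quivers are treated at once: sources are distinct and every arrow leads to the cyclic
    successor [ordS] of its source. The line is the circle with its last arrow deleted, which enters
    through [has_arrow]. Nesting has to be strict because arcs that cross, or that share a start or
    an end, always admit a nonzero map one way; this is why the inside loses two positions. The
    longest arc through vertex 0, of length i, can be placed in i ways on the circle but in one way
    on the line. Its inside is shorter than l and is counted by a Catalan number. Hence a_n = sum
    w_i a_(n-i) and b_n = sum i w_i a_(n-i), where w_i = c_(i-1) for i >= 2; w_1 = 2 also collects
    the sets without any arc through vertex 0. These w_i are the coefficients of F_l. The recurrence
    for b applies that of a at each n - i, which fails at 0, whence the condition n > l. Power
    series are replaced by polynomials modulo X^(n+1). *)

Lemma lfun_of_linear (K : fieldType) (U V : vectType K) (f : U -> V) :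
  linear f -> exists F : 'Hom(U, V), F =1 f.
Proof.
move=> fL.
pose g : {linear U -> V} := HB.pack f (GRing.isLinear.Build K U V _ f fL).
by exists (linfun g) => x; rewrite lfunE.
Qed.

Section ModuleAction.
Variables (K : fieldType) (A : kalgebra K) (M : rmodule A).

Lemma rmod_actZl k (v : M) (a : A) : rmod_act (k *: v) a = k *: rmod_act v a.
Proof. by rewrite -!rmod_actZ -!rmod_actM kscalar_central. Qed.

Lemma rmod_act_linear (a : A) : linear (fun v : M => rmod_act v a).
Proof. by move=> k u v; rewrite rmod_actDl rmod_actZl. Qed.

Lemma rmod_act0r (v : M) : rmod_act v 0 = 0.
Proof. by apply: (addIr (rmod_act v 0)); rewrite -rmod_actDr addr0 add0r. Qed.

Lemma rmod_act_sumr (v : M) I (r : seq I) P (F : I -> A) :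
  rmod_act v (\sum_(i <- r | P i) F i) = \sum_(i <- r | P i) rmod_act v (F i).
Proof. by apply: (big_morph _ _ (rmod_act0r v)) => x y; rewrite rmod_actDr. Qed.

End ModuleAction.

(** * Modules over truncated quiver algebras *)

Section TruncatedModules.
Variables (K : fieldType) (n : nat) (E : finType) (src tgt : E -> 'I_n).
Hypothesis src_inj : injective src.
Hypothesis tgtE : forall x, tgt x = ordS (src x).
Variable l : nat.
Notation Q := (Quiver src tgt).
Notation A := (truncated_path_algebra K Q l).
Implicit Types (M N : rmodule A) (p : qpath Q).

Definition vrot (i : 'I_n) (j : nat) : 'I_n := iter j (@ordS n) i.

(** In the linear quiver too, [vrot] runs from the last vertex to the first, where no arrow exists;
    this predicate records the gap. *)
Definition has_arrow (i : 'I_n) : bool := [exists x, src x == i].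

Definition pclass p : A := quotient_proj (@paths_of_length K Q l) (path_elt K p).

Lemma path_target_vrot p : path_target p = vrot (path_source p) (path_length p).
Proof.
case: p => [[v s] /= vs]; rewrite /path_target /path_length /path_source /=.
rewrite /path_arrows /=.
elim: s v vs => //= x s IHs v /andP[/eqP <- /IHs ->].
by rewrite /vrot -iterS iterSr -tgtE.
Qed.

Lemma pclassM p q : pclass p * pclass q =
  if path_cat p q is Some r then pclass r else 0.
Proof.
rewrite /pclass -[LHS]quotient_projM [X in quotient_proj _ X]path_mulU.
by rewrite /path_mul_basis; case: path_cat => //; rewrite raddf0.
Qed.

Lemma pclass_one : \sum_v pclass (@trivial_path Q v) = 1.
Proof. by rewrite -raddf_sum. Qed.

Lemma quotient_ideal_gen0 (B : kalgebra K) (X : set B) x :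
  X x -> quotient_proj X x = 0.
Proof.
move=> Xx; rewrite -(raddf0 (quotient_proj X)); apply/quotient_projE.
by rewrite subr0 => J [_]; apply.
Qed.

Lemma pclass_long p : path_length p = l -> pclass p = 0.
Proof. by move=> pl; apply: quotient_ideal_gen0; exists p. Qed.

Definition mkpath (i : 'I_n) (s : seq E) (ps : @is_path Q i s) : qpath Q :=
  exist _ (i, s) ps.

Definition arrow_path (x : E) : qpath Q :=
  @mkpath (src x) [:: x] (introT andP (conj (eqxx _) isT)).

Definition vact M (i : 'I_n) (v : M) : M :=
  rmod_act v (pclass (@trivial_path Q i)).

(** One operator stands for all the arrows: as [src] is injective, restricting it to the part of [M]
    at [src x] gives back the action of [x]. *)
Definition shift M (v : M) : M :=
  rmod_act v (\sum_x pclass (arrow_path x)).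

Lemma vact_linear M i : linear (@vact M i).
Proof. exact: rmod_act_linear. Qed.

Lemma shift_linear M : linear (@shift M).
Proof. exact: rmod_act_linear. Qed.

Lemma iter_shift_linear M k : linear (iter k (@shift M)).
Proof. by elim: k => // k IHk c u v; rewrite !iterS IHk shift_linear. Qed.

Lemma vact0 M i : vact i (0 : M) = 0.
Proof. by rewrite -[0 in LHS](scale0r (0 : M)) /vact rmod_actZl scale0r. Qed.

Lemma shift0 M : shift (0 : M) = 0.
Proof. by rewrite -[0 in LHS](scale0r (0 : M)) /shift rmod_actZl scale0r. Qed.

Lemma iter_shift0 M k : iter k (@shift M) 0 = 0.
Proof. by elim: k => //= k ->; rewrite shift0. Qed.

Lemma vact_vact M i j (v : M) : vact i (vact j v) = (i == j)%:R *: vact i v.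
Proof.
rewrite /vact -rmod_actM pclassM.
case: path_cat (path_catP (@trivial_path Q j) (@trivial_path Q i)).
  move=> r [ji sr _ ar]; have -> : i = j by [].
  rewrite eqxx scale1r; congr (rmod_act v (pclass _)).
  exact: path_inj.
by rewrite rmod_act0r /path_target /path_source /= eq_sym => /negPf->; rewrite scale0r.
Qed.

Lemma vact_sum M (v : M) : \sum_i vact i v = v.
Proof. by rewrite -rmod_act_sumr pclass_one rmod_act1. Qed.

Lemma arrow_vact M x i (v : M) : rmod_act (vact i v) (pclass (arrow_path x)) =
  (i == src x)%:R *: rmod_act v (pclass (arrow_path x)).
Proof.
rewrite /vact -rmod_actM pclassM.
case: path_cat (path_catP (@trivial_path Q i) (arrow_path x)).
  move=> r [ix sr _ ar]; have -> : i = src x by [].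
  rewrite eqxx scale1r; congr (rmod_act v (pclass _)).
  by apply: path_inj; rewrite // sr.
by rewrite rmod_act0r /path_target /path_source /= => /negPf->; rewrite scale0r.
Qed.

Lemma vact_arrow M x i (v : M) : vact i (rmod_act v (pclass (arrow_path x))) =
  (i == vrot (src x) 1)%:R *: rmod_act v (pclass (arrow_path x)).
Proof.
rewrite /vact -rmod_actM pclassM.
case: path_cat (path_catP (arrow_path x) (@trivial_path Q i)).
  move=> r [ix sr _ ar]; have -> : i = vrot (src x) 1 by rewrite -[LHS]ix path_target_vrot.
  rewrite eqxx scale1r; congr (rmod_act v (pclass _)).
  by apply: path_inj; rewrite // sr.
rewrite rmod_act0r path_target_vrot eq_sym => /negPf; rewrite /path_source /= => ->.
by rewrite scale0r.
Qed.

Lemma shift_vact M x (v : M) :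
  shift (vact (src x) v) = rmod_act v (pclass (arrow_path x)).
Proof.
rewrite /shift rmod_act_sumr (bigD1 x) //= big1 => [|y yx].
  by rewrite addr0 arrow_vact eqxx scale1r.
by rewrite arrow_vact eq_sym (inj_eq src_inj) (negPf yx) scale0r.
Qed.

Lemma shift_vact0 M i (v : M) : ~~ has_arrow i -> shift (vact i v) = 0.
Proof.
move=> ni; rewrite /shift rmod_act_sumr big1 // => x _; rewrite arrow_vact.
by case: eqP => [ix|]; rewrite ?scale0r //; case/existsP: ni; exists x; rewrite ix.
Qed.

Lemma vact_shift M i (v : M) : vact (vrot i 1) (shift v) = shift (vact i v).
Proof.
rewrite /shift !rmod_act_sumr.
rewrite (big_morph (vact (vrot i 1)) (id1 := 0) (op1 := +%R)); last first.
- exact: vact0.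
- by move=> u w; rewrite /vact rmod_actDl.
by apply: eq_bigr => x _; rewrite vact_arrow arrow_vact /vrot /= (inj_eq (@ordS_inj _)).
Qed.

Lemma vrotD i a b : vrot i (a + b) = vrot (vrot i a) b.
Proof. by rewrite /vrot addnC iterD. Qed.

Lemma vact_iter M i k (v : M) :
  vact (vrot i k) (iter k (@shift M) v) = iter k (@shift M) (vact i v).
Proof.
by elim: k => //= k IHk; rewrite -IHk -vact_shift.
Qed.

(** At most one path of a given length leaves a vertex, so a path acts only through its source and
    its length. *)
Lemma pclass_act M p (v : M) :
  rmod_act v (pclass p) = iter (path_length p) (@shift M) (vact (path_source p) v).
Proof.
case: p => [[i s] /= ps]; rewrite /path_length /path_source /path_arrows /=.
rewrite -/(mkpath ps); elim: s i ps v => [|x s IHs] i ps v.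
  by congr (rmod_act v (pclass _)); apply: val_inj.
have /andP[/eqP xi ps'] := ps.
have -> : pclass (mkpath ps) = pclass (arrow_path x) * pclass (mkpath ps').
  rewrite pclassM.
  case: path_cat (path_catP (arrow_path x) (mkpath ps')).
    move=> r [_ sr _ ar]; congr pclass; apply: path_inj; last by rewrite [RHS]ar.
    by rewrite [RHS]sr -[LHS]xi.
  by rewrite /path_target /path_source /= eqxx.
rewrite rmod_actM IHs [RHS]iterSr -[in RHS]xi shift_vact.
by rewrite vact_arrow /= tgtE eqxx scale1r.
Qed.

(** Following arrows from [i] either succeeds for [k] steps, which gives a path, or meets a vertex
    without arrow, where [shift] kills the vector. *)
Lemma iter_shift_path M k i (v : M) : iter k (@shift M) (vact i v) = 0 \/
  exists p, [/\ path_length p = k, path_source p = i &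
     iter k (@shift M) (vact i v) = rmod_act v (pclass p)].
Proof.
elim: k i v => [|k IHk] i v.
  by right; exists (@trivial_path Q i).
have [/existsP[x /eqP xi]|/shift_vact0 ni] := boolP (has_arrow i); last first.
  by left; rewrite iterSr ni iter_shift0.
rewrite iterSr -xi -vact_shift.
case: (IHk (vrot (src x) 1) (shift v)) => [|[p [pk ps ->]]]; first by left.
right; have xp : is_path (Q := Q) (src x) (x :: path_arrows p).
  by rewrite /= eqxx /= tgtE -[ordS _]/(vrot (src x) 1) -ps; case: p {pk ps}.
exists (mkpath xp); split => //.
  by rewrite -pk.
rewrite [RHS]pclass_act; have -> : path_length (mkpath xp) = k.+1 by rewrite -pk.
by rewrite !pclass_act pk ps vact_shift -iterSr.
Qed.

Lemma iter_shift_l M (v : M) : iter l (@shift M) v = 0.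
Proof.
have [F FE] := lfun_of_linear (@iter_shift_linear M l).
rewrite -FE -[v]vact_sum linear_sum big1 // => i _; rewrite [LHS]FE.
case: (iter_shift_path l i v) => [//|[p [pl _ ->]]].
by rewrite pclass_long // rmod_act0r.
Qed.

(** The list [s] is chosen before the module, so that both sides of a homomorphism equation expand
    along the same paths. *)
Lemma act_pclass (a : A) : exists s : seq (K * qpath Q),
  forall N (u : N), rmod_act u a = \sum_(x <- s) x.1 *: rmod_act u (pclass x.2).
Proof.
pose x := generic_quotient.repr a.
exists [seq (mcoeff p x, p) | p <- msupp x] => N u.
rewrite big_map -[in LHS](quotient_reprK a) -/x {1}[x]path_eltE raddf_sum rmod_act_sumr.
apply: eq_bigr => p _ /=.
have -> : quotient_proj (@paths_of_length K Q l) (mcoeff p x *: path_elt K p) =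
    kscalar A (mcoeff p x) * pclass p.
  rewrite -[RHS]quotient_projM; congr quotient_proj.
  by rewrite [RHS]path_mulZl path_mul1.
by rewrite rmod_actM rmod_actZ rmod_actZl.
Qed.

Lemma is_rhomP M N (f : 'Hom(M, N)) : is_rhom f <->
  (forall i v, f (vact i v) = vact i (f v)) /\ (forall v, f (shift v) = shift (f v)).
Proof.
split=> [fh|[fE fT] v a]; first by split=> *; apply: fh.
have fTk k u : f (iter k (@shift M) u) = iter k (@shift N) (f u).
  by elim: k => //= k IHk; rewrite fT IHk.
have [s sE] := act_pclass a; rewrite !sE linear_sum; apply: eq_bigr => -[c p] _ /=.
by rewrite linearZ !pclass_act /= fTk fE.
Qed.

End TruncatedModules.

Arguments vact : simpl never.
Arguments shift : simpl never.

(** * Modules from matrices attached to paths *)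

Section MatrixModule.
Variables (K : fieldType) (Q : quiver) (d l : nat) (R : qpath Q -> 'M[K]_d).
Hypothesis R_mul : forall p q,
  R p *m R q = if path_cat p q is Some r then R r else 0.
Hypothesis R_one : \sum_v R (trivial_path v) = 1%:M.
Hypothesis R_long : forall p, path_length p = l -> R p = 0.
Notation X := (@paths_of_length K Q l).
Notation A := (truncated_path_algebra K Q l).

Definition path_rep (f : path_algebra K Q) : 'M[K]_d :=
  \sum_(p <- msupp f) mcoeff p f *: R p.

Lemma path_rep_wide (f : path_algebra K Q) (D : {fset qpath Q}) :
  (msupp f `<=` D)%fset -> path_rep f = \sum_(p <- D) mcoeff p f *: R p.
Proof.
move=> fD; rewrite /path_rep (big_fset_incl _ fD) //= => p _ /mcoeff_outdom ->.
by rewrite scale0r.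
Qed.

Lemma path_repD (f g : path_algebra K Q) :
  path_rep (f + g) = path_rep f + path_rep g.
Proof.
rewrite (path_rep_wide (msuppD_le f g)) (path_rep_wide (fsubsetUl _ (msupp g))).
rewrite (path_rep_wide (fsubsetUr (msupp f) _)) -big_split /=.
by apply: eq_bigr => p _; rewrite mcoeffD scalerDl.
Qed.

Lemma path_repZ k (f : path_module K Q) :
  path_rep (k *: f) = k *: path_rep f.
Proof.
rewrite (path_rep_wide (msuppZ_le k f)) /path_rep scaler_sumr.
by apply: eq_bigr => p _; rewrite mcoeffZ scalerA.
Qed.

Lemma path_rep0 : path_rep 0 = 0.
Proof. by have := path_repZ 0 0; rewrite !scale0r. Qed.

Lemma path_repB (f g : path_algebra K Q) :
  path_rep (f - g) = path_rep f - path_rep g.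
Proof. by apply: (addIr (path_rep g)); rewrite -path_repD !subrK. Qed.

Lemma path_rep_sum I (r : seq I) P (F : I -> path_module K Q) :
  path_rep (\sum_(i <- r | P i) F i) = \sum_(i <- r | P i) path_rep (F i).
Proof. exact: (big_morph path_rep path_repD path_rep0). Qed.

Lemma path_rep_elt p : path_rep (path_elt K p) = R p.
Proof.
by rewrite path_elt.unlock (path_rep_wide msuppU_le) big_seq_fset1 mcoeffUU scale1r.
Qed.

Lemma path_repM (f g : path_algebra K Q) :
  path_rep (f * g) = path_rep f *m path_rep g.
Proof.
rewrite -[f * g]/(path_mul f g) path_mul.unlock path_rep_sum mulmx_suml.
apply: eq_bigr => p _; rewrite path_rep_sum mulmx_sumr; apply: eq_bigr => q _.
rewrite path_repZ -scalemxAl -scalemxAr scalerA R_mul /path_mul_basis.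
by case: path_cat => [r|]; rewrite ?path_rep_elt ?path_rep0.
Qed.

Lemma path_rep1 : path_rep (1 : path_algebra K Q) = 1%:M.
Proof.
rewrite -[1]/(path_one K Q) /path_one path_rep_sum -R_one.
by apply: eq_bigr => v _; rewrite path_rep_elt.
Qed.

Lemma path_rep_ideal (f : path_algebra K Q) : ideal_gen X f -> path_rep f = 0.
Proof.
(* The kernel of [path_rep] is a two-sided ideal containing the paths of length [l]. *)
pose J : set (path_algebra K Q) := fun f => path_rep f = 0.
move=> /(_ J); apply; split; last by move=> g [p pl ->]; rewrite /J path_rep_elt R_long.
rewrite /J; split=> [|f' g f0 g0|g f' f0|g f' f0]; rewrite /= ?path_rep0 //.
- by rewrite path_repB f0 g0 subr0.
- by rewrite path_repM f0 mulmx0.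
- by rewrite path_repM f0 mul0mx.
Qed.

Definition quotient_rep (a : A) : 'M[K]_d := path_rep (generic_quotient.repr a).

Lemma quotient_rep_proj f : quotient_rep (quotient_proj X f) = path_rep f.
Proof.
apply: subr0_eq; rewrite -path_repB; apply: path_rep_ideal.
by apply/quotient_projE; rewrite quotient_reprK.
Qed.

Definition mx_rmodule : rmodule A.
Proof.
pose act (v : 'rV[K]_d) (a : A) := v *m quotient_rep a.
apply: (@RModule K A d act).
- by move=> u v a; rewrite /act mulmxDl.
- move=> v a b; rewrite /act -mulmxDr; congr (_ *m _).
  by rewrite -[a]quotient_reprK -[b]quotient_reprK -quotient_projD !quotient_rep_proj path_repD.
- by move=> v; rewrite /act [quotient_rep _]quotient_rep_proj path_rep1 mulmx1.
- move=> v a b; rewrite /act -mulmxA; congr (_ *m _).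
  rewrite -[a]quotient_reprK -[b]quotient_reprK -[_ * _]quotient_projM.
  by rewrite !quotient_rep_proj path_repM.
- move=> v k; rewrite /act [quotient_rep _]quotient_rep_proj path_repZ path_rep1.
  by rewrite -scalemxAr mulmx1.
Defined.

Lemma mx_rmodule_act (v : mx_rmodule) p :
  rmod_act v (quotient_proj X (path_elt K p)) = v *m R p.
Proof. by rewrite -[LHS]/(v *m quotient_rep _) quotient_rep_proj path_rep_elt. Qed.

End MatrixModule.

(** * Uniserial modules and bricks *)

(** The forward distance from [j] to [i], that is [i - j] modulo [n]; cases instead of a remainder
    keep it within linear arithmetic. *)
Definition arc_diff n (i j : 'I_n) : nat := (if j <= i then i - j else i + n - j)%N.

Lemma val_vrot n (i : 'I_n) a : vrot i a = ((i + a) %% n)%N :> nat.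
Proof.
elim: a => [|a IHa]; first by rewrite addn0 modn_small.
by rewrite /vrot /= IHa -addn1 modnDml addn1 addnS.
Qed.

Lemma arc_diff_lt n (i j : 'I_n) : (arc_diff i j < n)%N.
Proof. by rewrite /arc_diff; have := ltn_ord i; have := ltn_ord j; case: ifP; lia. Qed.

Lemma vrot_arc_diff n (i j : 'I_n) : vrot j (arc_diff i j) = i.
Proof.
apply: val_inj; rewrite /= val_vrot /arc_diff.
have := ltn_ord i; have := ltn_ord j; case: ifP => ji jn lt_in.
  by rewrite subnKC // modn_small.
by rewrite subnKC ?modnDr ?modn_small //; lia.
Qed.

Lemma vrot_eq n (i j : 'I_n) a : (a < n)%N -> vrot j a = i -> a = arc_diff i j.
Proof.
move=> an /(congr1 val); rewrite /= val_vrot /arc_diff.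
have := ltn_ord i; have := ltn_ord j => jn lt_in.
case: (ltnP (j + a)%N n) => ja; first by rewrite modn_small // => <-; rewrite leq_addr; lia.
rewrite -[(j + a)%N](subnK ja) modnDr modn_small; last by lia.
by move=> <-; case: ifP; lia.
Qed.

Lemma vrot_n n (i : 'I_n) : vrot i n = i.
Proof. by apply: val_inj; rewrite /= val_vrot modnDr modn_small. Qed.

Section StringModules.
Variables (K : fieldType) (n : nat) (E : finType) (src tgt : E -> 'I_n).
Hypothesis src_inj : injective src.
Hypothesis tgtE : forall x, tgt x = ordS (src x).
Variable l : nat.
Notation Q := (Quiver src tgt).
Notation A := (truncated_path_algebra K Q l).
Notation has_arrow := (has_arrow src).
Implicit Types (M N : rmodule A) (p : qpath Q).

(** Basis vector [j] sits at the vertex [vrot i j]; a path starting there moves it forward by its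
    length, and to 0 beyond the end. *)
Definition string_mx (i : 'I_n) m p : 'M[K]_m :=
  \matrix_(j, k) ((path_source p == vrot i j) && (k == j + path_length p :> nat)%N)%:R.

(** Indices [j >= m] are allowed and give 0, so that the shift formulas have no boundary case. *)
Definition string_vec m (j : nat) : 'rV[K]_m := \row_k (k == j :> nat)%:R.

Lemma string_vec_eq0 m j : (m <= j)%N -> string_vec m j = 0.
Proof.
move=> mj; apply/rowP => k; rewrite !mxE; case: eqP => // kj.
by have := ltn_ord k; lia.
Qed.

Lemma string_vec_sum m (v : 'rV[K]_m) : v = \sum_(j < m) v 0 j *: string_vec m j.
Proof.
apply/rowP => k; rewrite summxE (bigD1 k) //= !mxE eqxx mulr1 big1 ?addr0 // => j jk.
by rewrite !mxE eq_sym (inj_eq val_inj) (negPf jk) mulr0.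
Qed.

Lemma string_vec_mul i m j p : string_vec m j *m string_mx i m p =
  (path_source p == vrot i j)%:R *: string_vec m (j + path_length p)%N.
Proof.
have [mj|jm] := leqP m j.
  by rewrite !string_vec_eq0 ?mul0mx ?scaler0 //; lia.
apply/rowP => k; rewrite !mxE (bigD1 (Ordinal jm)) //= !mxE eqxx mul1r big1 ?addr0.
  by rewrite -mulnb natrM.
by move=> a aj; rewrite !mxE -[_ == j]/(a == Ordinal jm) (negPf aj) mul0r.
Qed.

Lemma string_vec_ext m d (F G : 'M[K]_(m, d)) :
  (forall j, string_vec m j *m F = string_vec m j *m G) -> F = G.
Proof.
move=> FG; apply/row_matrixP => a; rewrite -[LHS]/(row a F) !rowE.
have -> : delta_mx 0 a = string_vec m a :> 'rV[K]_m by apply/rowP => k; rewrite !mxE eqxx.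
exact: FG.
Qed.

Lemma string_mx_mul i m p q : string_mx i m p *m string_mx i m q =
  if path_cat p q is Some r then string_mx i m r else 0.
Proof.
apply: string_vec_ext => j; rewrite mulmxA string_vec_mul -scalemxAl string_vec_mul.
case: path_cat (path_catP p q) => [r [pq sr _ ar]|npq].
  rewrite string_vec_mul sr scalerA -natrM mulnb /path_length ar size_cat addnA.
  case: eqP => //= sp; rewrite -pq (path_target_vrot tgtE) sp /path_length.
  by rewrite -vrotD eqxx.
rewrite mulmx0; case: eqP => sp; last by rewrite scale0r.
by rewrite vrotD -sp -(path_target_vrot tgtE) eq_sym (negPf npq) scale0r scaler0.
Qed.

Lemma string_mx_one i m : \sum_v string_mx i m (@trivial_path Q v) = 1%:M.
Proof.
apply: string_vec_ext => j; rewrite mulmx1 mulmx_sumr (bigD1 (vrot i j)) //= big1.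
  by rewrite string_vec_mul addn0 eqxx scale1r addr0.
by move=> v /negPf vj; rewrite string_vec_mul /path_source /= vj scale0r.
Qed.

Lemma string_mx_long i m (ml : (m <= l)%N) p : path_length p = l -> string_mx i m p = 0.
Proof.
move=> pl; apply: string_vec_ext => j; rewrite string_vec_mul mulmx0.
by rewrite string_vec_eq0 ?scaler0 //; lia.
Qed.

Definition string_mod i m (ml : (m <= l)%N) : rmodule A :=
  mx_rmodule (@string_mx_mul i m) (string_mx_one i m) (@string_mx_long i m ml).

(** [string_mod] is a module for every [i] and every [m <= l]; a missing arrow only cuts it into
    direct summands. The [m - 1] arrows required here make it uniserial. *)
Definition full_string i m := forall j, (j.+1 < m)%N -> has_arrow (vrot i j).

Section OneString.
Variables (i : 'I_n) (m : nat) (ml : (m <= l)%N).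
Notation S := (string_mod i ml).
Notation x := (string_vec m : nat -> S).

Lemma string_act j p : rmod_act (x j) (pclass K l p) =
  (path_source p == vrot i j)%:R *: x (j + path_length p)%N.
Proof. by rewrite /pclass [LHS]mx_rmodule_act string_vec_mul. Qed.

Lemma string_vact v j : vact v (x j) = (v == vrot i j)%:R *: x j.
Proof. by rewrite /vact string_act addn0. Qed.

Lemma string_vact_entry v (w : S) j :
  (vact v w : 'rV_m) 0 j = (v == vrot i j)%:R * (w : 'rV_m) 0 j.
Proof.
rewrite /vact /pclass [rmod_act _ _]mx_rmodule_act mxE (bigD1 j) //= big1 => [|k kj].
  by rewrite !mxE addn0 eqxx andbT addr0 mulrC.
by rewrite !mxE addn0 [X in _ && X]eq_sym (inj_eq val_inj) (negPf kj) andbF mulr0.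
Qed.

Hypothesis Sf : full_string i m.

Lemma string_shift j : shift (x j) = x j.+1.
Proof.
have [mj|jm] := leqP m j.+1.
  have xj : x j = vact (vrot i j) (x j) by rewrite string_vact eqxx scale1r.
  rewrite [RHS]string_vec_eq0 // xj.
  case: (boolP (has_arrow (vrot i j))) => [/existsP[a /eqP aj]|/shift_vact0 -> //].
  rewrite -aj (shift_vact src_inj) string_act string_vec_eq0 ?scaler0 //.
  by rewrite addn1.
have /existsP[a /eqP aj] := Sf jm.
have xj : x j = vact (vrot i j) (x j) by rewrite string_vact eqxx scale1r.
rewrite xj -aj (shift_vact src_inj) string_act /path_source /= aj eqxx scale1r.
by rewrite addn1.
Qed.

Lemma string_iter_shift j k : iter k (@shift _ _ _ _ _ _ S) (x j) = x (j + k)%N.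
Proof. by elim: k => [|k IHk]; rewrite ?addn0 // iterS IHk string_shift addnS. Qed.

Lemma string_hom_ext N (f g : 'Hom(S, N)) :
  (forall j, (j < m)%N -> f (x j) = g (x j)) -> f =1 g.
Proof.
move=> fg v; rewrite [v]string_vec_sum !linear_sum; apply: eq_bigr => j _.
by rewrite !linearZ /= fg.
Qed.

(** The module is cyclic on [x 0], which lies at [i], with T^m x = 0 as the only further relation;
    so the image of [x 0] can be any such vector. *)
Lemma string_hom N (w : N) : vact i w = w ->
  iter m (@shift _ _ _ _ _ _ N) w = 0 ->
  exists f : 'Hom(S, N), is_rhom f /\
    forall j, f (x j) = iter j (@shift _ _ _ _ _ _ N) w.
Proof.
move=> iw mw; pose T k (u : N) := iter k (@shift _ _ _ _ _ _ N) u.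
have [f fE] : exists f : 'Hom(S, N), f =1 (fun v : 'rV_m => \sum_(j < m) v 0 j *: T j w).
  apply: lfun_of_linear => c u v; rewrite scaler_sumr -big_split /=.
  by apply: eq_bigr => j _; rewrite !mxE scalerDl scalerA.
have fx j : f (x j) = T j w.
  have [mj|jm] := leqP m j.
    rewrite string_vec_eq0 // linear0 -(subnK mj) /T iterD mw.
    by rewrite iter_shift0.
  rewrite fE (bigD1 (Ordinal jm)) //= mxE eqxx scale1r big1 ?addr0 // => k kj.
  by rewrite mxE -[_ == j]/(k == Ordinal jm) (negPf kj) scale0r.
exists f; split=> //; apply/(is_rhomP src_inj tgtE); split.
  move=> v u.
  have [F FE] := lfun_of_linear (@vact_linear K n E src tgt l S v).
  have [G GE] := lfun_of_linear (@vact_linear K n E src tgt l N v).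
  have := @string_hom_ext N (f \o F)%VF (G \o f)%VF.
  move=> /(_ _ u); rewrite !comp_lfunE FE GE; apply => j _.
  rewrite !comp_lfunE FE GE fx string_vact linearZ /= fx.
  have tj : vact (vrot i j) (T j w) = T j w by rewrite /T (vact_iter tgtE) iw.
  rewrite -[in RHS]tj vact_vact; case: eqP => [->|_]; last by rewrite !scale0r.
  by rewrite tj.
move=> u.
have [F FE] := lfun_of_linear (@shift_linear K n E src tgt l S).
have [G GE] := lfun_of_linear (@shift_linear K n E src tgt l N).
have := @string_hom_ext N (f \o F)%VF (G \o f)%VF.
move=> /(_ _ u); rewrite !comp_lfunE FE GE; apply => j _.
by rewrite !comp_lfunE FE GE fx string_shift fx.
Qed.

End OneString.

End StringModules.

Lemma vrot_inj n (i : 'I_n) a b : (a < n)%N -> (b < n)%N ->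
  vrot i a = vrot i b -> a = b.
Proof. by move=> an bn ab; apply: etrans (vrot_eq an ab) (esym (vrot_eq bn erefl)). Qed.

(* The arc (i, m) stands for the uniserial module with top i and length m.  A
   nonzero map from x to y must send the generator to the basis vector of y at
   distance s = arc_diff x.1 y.1 from its top, so s < y.2, and T^(x.2) must kill
   that vector, so y.2 <= s + x.2. *)
Definition arc_hom n (x y : 'I_n * nat) : bool :=
  (arc_diff x.1 y.1 < y.2 <= arc_diff x.1 y.1 + x.2)%N.

Section StringBricks.
Variables (K : fieldType) (n : nat) (E : finType) (src tgt : E -> 'I_n).
Hypothesis src_inj : injective src.
Hypothesis tgtE : forall x, tgt x = ordS (src x).
Variable l : nat.
Notation Q := (Quiver src tgt).
Notation A := (truncated_path_algebra K Q l).
Notation has_arrow := (has_arrow src).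
Notation full_string := (full_string src).
Notation string_mod := (string_mod K tgtE).
Notation T M := (@shift K n E src tgt l M).
Implicit Types (M N : rmodule A) (p : qpath Q).

Lemma rhom_vact M N (f : 'Hom(M, N)) i v : is_rhom f -> f (vact i v) = vact i (f v).
Proof. by move=> fh; have [fE _] := (is_rhomP src_inj tgtE f).1 fh. Qed.

Lemma rhom_shift M N (f : 'Hom(M, N)) k v : is_rhom f ->
  f (iter k (T M) v) = iter k (T N) (f v).
Proof.
move=> fh; have [_ fT] := (is_rhomP src_inj tgtE f).1 fh.
by elim: k => // k IHk; rewrite !iterS fT IHk.
Qed.

Section Fixed.
Variables (i : 'I_n) (m : nat) (ml : (m <= l)%N).
Notation S := (string_mod i ml).
Notation x := (string_vec K m : nat -> S).

(** Since [m <= n], the basis vectors lie at distinct vertices and each vertex space has dimension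
    at most 1. *)
Lemma string_vact_fixed (w : S) k : (m <= n)%N -> (k < n)%N ->
  vact (vrot i k) w = w -> exists c, w = c *: x k.
Proof.
(* The sum is coordinate [k] of [w], or 0 if [k >= m], in which case [x k] is 0 as well. *)
move=> mn kn kw; exists (\sum_(a < m | a == k :> nat) (w : 'rV_m) 0 a).
apply/rowP => j; rewrite [RHS]mxE [X in _ * X]mxE.
have := string_vact_entry (vrot i k) w j; rewrite kw => ->.
have [jk|jk] := eqVneq (j : nat) k.
  rewrite jk eqxx mulr1 mul1r; rewrite (bigD1 j) /= ?jk // big1 ?addr0 // => a.
  by move=> /andP[/eqP ak /eqP []]; apply: val_inj; rewrite /= ak jk.
rewrite mulr0; case: eqP => [/vrot_inj kj|_]; last by rewrite mul0r.
by move: jk; rewrite kj ?eqxx // (leq_trans (ltn_ord j)).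
Qed.

Lemma string_vec_neq0 k : (k < m)%N -> x k != 0.
Proof.
move=> km; apply/eqP => /rowP /(_ (Ordinal km)); rewrite !mxE eqxx => /eqP.
by rewrite oner_eq0.
Qed.

Hypothesis Sf : full_string i m.

Lemma string_rhomE N (f : 'Hom(S, N)) j : is_rhom f -> f (x j) = iter j (T N) (f (x 0)).
Proof.
by move=> fh; rewrite -(rhom_shift _ _ fh) (string_iter_shift K src_inj tgtE ml Sf).
Qed.

Lemma string_rhom_eq0 N (f : 'Hom(S, N)) : is_rhom f -> f (x 0) = 0 -> f = 0.
Proof.
move=> fh f0; apply/lfunP; apply: string_hom_ext => j _.
by rewrite string_rhomE // f0 iter_shift0 lfunE.
Qed.

Lemma string_gen_fixed : vact i (x 0) = x 0.
Proof. by rewrite string_vact eqxx scale1r. Qed.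

(** Vertex spaces are at most one-dimensional, so an endomorphism multiplies the generator, and with
    it the whole module, by a scalar. *)
Lemma string_mod_brick : (0 < m <= n)%N -> brick S.
Proof.
case/andP=> m0 mn; split.
  move=> /lfunP /(_ (x 0)); rewrite id_lfunE lfunE /=; apply/eqP.
  exact: string_vec_neq0.
move=> f fh f0.
have fix0 : vact i (f (x 0)) = f (x 0) by rewrite -(rhom_vact _ _ fh) string_gen_fixed.
have [c fc] := @string_vact_fixed (f (x 0)) 0 mn (leq_trans m0 mn) fix0.
have fE v : f v = c *: v.
  have -> : c *: v = (c *: \1%VF : 'End(S)) v by rewrite lfunE /= id_lfunE.
  apply: string_hom_ext => j _; rewrite string_rhomE // fc.
  have [F FE] := lfun_of_linear (@iter_shift_linear K n E src tgt l S j).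
  rewrite -FE linearZ /= FE (string_iter_shift K src_inj tgtE ml Sf).
  by rewrite lfunE /= id_lfunE.
have c0 : c != 0.
  apply/eqP => c0; apply: f0; apply/lfunP => v.
  by rewrite fE c0 scale0r lfunE.
have gE v : (c^-1 *: \1%VF : 'End(S)) v = c^-1 *: v by rewrite lfunE /= id_lfunE.
exists (c^-1 *: \1%VF); split.
- by move=> v a; rewrite !gE rmod_actZl.
- by apply/lfunP => v; rewrite comp_lfunE fE gE id_lfunE scalerA divff // scale1r.
- by apply/lfunP => v; rewrite comp_lfunE fE gE id_lfunE scalerA mulVf // scale1r.
Qed.

End Fixed.

Section TwoStrings.
Variables (i j : 'I_n) (m k : nat) (ml : (m <= l)%N) (kl : (k <= l)%N).
Hypotheses (fi : full_string i m) (fj : full_string j k) (kn : (k <= n)%N).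

Lemma string_rhom0 (f : 'Hom(string_mod i ml, string_mod j kl)) :
  ~~ arc_hom (i, m) (j, k) -> is_rhom f -> f = 0.
Proof.
rewrite /arc_hom /=; set s := arc_diff i j => nh fh.
apply: (string_rhom_eq0 fi fh).
have fix0 : vact (vrot j s) (f (string_vec K m 0)) = f (string_vec K m 0).
  by rewrite vrot_arc_diff -(rhom_vact _ _ fh) string_gen_fixed.
have [c fc] := string_vact_fixed kn (arc_diff_lt i j) fix0.
rewrite fc; have [ks|sk] := leqP k s; first by rewrite string_vec_eq0 ?scaler0.
have smk : (s + m < k)%N by lia.
have : f (string_vec K m m) = c *: string_vec K k (s + m)%N.
  rewrite string_rhomE // fc.
  have [F FE] := lfun_of_linear (@iter_shift_linear K n E src tgt l (string_mod j kl) m).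
  by rewrite -FE linearZ /= FE (string_iter_shift K src_inj tgtE kl fj).
rewrite string_vec_eq0 // linear0 => /esym/eqP; rewrite scaler_eq0.
by rewrite (negPf (string_vec_neq0 j kl smk)) orbF => /eqP ->; rewrite scale0r.
Qed.

Lemma string_rhom_neq0 : arc_hom (i, m) (j, k) -> (0 < m)%N ->
  exists2 f : 'Hom(string_mod i ml, string_mod j kl), is_rhom f & f <> 0.
Proof.
rewrite /arc_hom /=; set s := arc_diff i j => /andP[sk ksm] m0.
have [||f [fh fE]] :=
  @string_hom K n E src tgt src_inj tgtE l i m ml fi (string_mod j kl) (string_vec K k s).
- by rewrite string_vact vrot_arc_diff eqxx scale1r.
- by rewrite (string_iter_shift K src_inj tgtE kl fj) string_vec_eq0.
exists f => // f0; have := fE 0; rewrite f0 lfunE /= => /esym/eqP.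
by rewrite (negPf (string_vec_neq0 j kl sk)).
Qed.

(** Injectivity keeps the last basis vector alive, and its image lies [s + m.-1] steps into the
    target. Used for an isomorphism and for its inverse, the bound forces distance 0 and equal
    lengths. *)
Lemma string_mono_le (f : 'Hom(string_mod i ml, string_mod j kl)) :
  (0 < m)%N -> is_rhom f -> injective f -> (arc_diff i j + m <= k)%N.
Proof.
move=> m0 fh f_inj; set s := arc_diff i j.
have fix0 : vact (vrot j s) (f (string_vec K m 0)) = f (string_vec K m 0).
  by rewrite vrot_arc_diff -(rhom_vact _ _ fh) string_gen_fixed.
have [c fc] := string_vact_fixed kn (arc_diff_lt i j) fix0.
have : f (string_vec K m m.-1) = c *: string_vec K k (s + m.-1)%N.
  rewrite string_rhomE // fc.
  have [F FE] := lfun_of_linear (@iter_shift_linear K n E src tgt l (string_mod j kl) m.-1).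
  by rewrite -FE linearZ /= FE (string_iter_shift K src_inj tgtE kl fj).
have [ks|sk _] := leqP k (s + m.-1); last by lia.
rewrite (string_vec_eq0 K ks) scaler0 -(linear0 f) => /f_inj/eqP.
have mm : (m.-1 < m)%N by lia.
by rewrite (negPf (string_vec_neq0 i ml mm)).
Qed.

End TwoStrings.

Lemma string_iso_arc (i j : 'I_n) (m k : nat) (ml : (m <= l)%N) (kl : (k <= l)%N) :
  full_string i m -> full_string j k -> (0 < m <= n)%N -> (0 < k <= n)%N ->
  rmod_iso (string_mod i ml) (string_mod j kl) -> (i, m) = (j, k).
Proof.
move=> fi fj /andP[m0 mn] /andP[k0 kn] [f [g [fh gh fK gK]]].
have := string_mono_le fi fj kn m0 fh (can_inj fK).
have := string_mono_le fj fi mn k0 gh (can_inj gK).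
move=> d1 d2; have d0 : arc_diff i j = 0%N by lia.
have -> : m = k by lia.
by rewrite -(vrot_arc_diff i j) d0.
Qed.

End StringBricks.

Section ModuleIsomorphism.
Variables (K : fieldType) (A : kalgebra K).
Implicit Types M N P : rmodule A.

Lemma rmod_iso_refl M : rmod_iso M M.
Proof.
exists \1%VF, \1%VF; split; do ?by move=> v; rewrite !id_lfunE.
all: by move=> v a; rewrite !id_lfunE.
Qed.

Lemma rmod_iso_sym M N : rmod_iso M N -> rmod_iso N M.
Proof. by move=> [f [g [? ? ? ?]]]; exists g, f. Qed.

Lemma rmod_iso_trans M N P : rmod_iso M N -> rmod_iso N P -> rmod_iso M P.
Proof.
move=> [f [g [fh gh fK gK]]] [f' [g' [fh' gh' fK' gK']]].
exists (f' \o f)%VF, (g \o g')%VF; split.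
- by move=> v a; rewrite !comp_lfunE fh fh'.
- by move=> v a; rewrite !comp_lfunE gh' gh.
- by move=> v; rewrite !comp_lfunE fK' fK.
- by move=> v; rewrite !comp_lfunE gK gK'.
Qed.

Lemma isoclass_eqP M N : isoclass M = isoclass N <-> rmod_iso M N.
Proof.
split=> [MN|MN]; last first.
  apply/seteqP; split=> P /= hP; last exact: rmod_iso_trans MN hP.
  exact: rmod_iso_trans (rmod_iso_sym MN) hP.
have : isoclass N N by exact: rmod_iso_refl.
by rewrite -MN.
Qed.

End ModuleIsomorphism.

Section BrickClassification.
Variables (K : fieldType) (n : nat) (E : finType) (src tgt : E -> 'I_n).
Hypothesis src_inj : injective src.
Hypothesis tgtE : forall x, tgt x = ordS (src x).
Variable l : nat.
Notation Q := (Quiver src tgt).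
Notation A := (truncated_path_algebra K Q l).
Notation has_arrow := (has_arrow src).
Notation full_string := (full_string src).
Notation string_mod := (string_mod K tgtE).
Notation T M := (@shift K n E src tgt l M).

(* [T ^ n] is an endomorphism, and it is nilpotent. *)
Lemma brick_nilpotency_le (M : rmodule A) m (v : M) : brick M ->
  (forall w : M, iter m (T M) w = 0) -> iter m.-1 (T M) v <> 0 -> (m <= n)%N.
Proof.
move=> [_ Mb] Tm Tv; rewrite leqNgt; apply/negP => nm.
have n0 : (0 < n)%N.
  rewrite lt0n; apply/eqP => n0; apply: Tv.
  rewrite -[v](vact_sum v) big1 ?iter_shift0 // => i; exfalso.
  by have := ltn_ord i; lia.
have [F FE] := lfun_of_linear (@iter_shift_linear K n E src tgt l M n).
have [||g [_ gF _]] := Mb F.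
- apply/(is_rhomP src_inj tgtE); split=> [i w|w].
    by rewrite !FE -(vact_iter tgtE) vrot_n.
  by rewrite !FE -iterSr iterS.
- move=> F0; apply: Tv; have -> : m.-1 = (m.-1 - n + n)%N by lia.
  rewrite iterD; have := FE v; rewrite F0 lfunE /= => <-.
  exact: iter_shift0.
(* One use of the inverse suffices: v = T^n (g v), so T^(m-1) v is an iterate of order at least [m]
   and vanishes. *)
have : (F \o g)%VF v = v by rewrite gF id_lfunE.
rewrite comp_lfunE FE => vE; apply: Tv; rewrite -vE -iterD.
have -> : (m.-1 + n = (m.-1 + n - m) + m)%N by lia.
by rewrite iterD Tm iter_shift0.
Qed.

Lemma vrotI a : injective (fun i : 'I_n => vrot i a).
Proof. by elim: a => // a IHa i j /ordS_inj /IHa. Qed.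

Lemma string_shift_entry i m (ml : (m <= l)%N) (w : string_mod i ml) (j : 'I_m) :
  full_string i m ->
  (shift w : 'rV_m) 0 j = \sum_(a < m | a.+1 == j :> nat) (w : 'rV_m) 0 a.
Proof.
move=> fi; have [F FE] := lfun_of_linear (@shift_linear K n E src tgt l (string_mod i ml)).
rewrite -FE {1}[w](string_vec_sum w) linear_sum summxE [RHS]big_mkcond.
apply: eq_bigr => a _; rewrite linearZ /= mxE FE (string_shift K src_inj tgtE ml fi) mxE.
by rewrite eq_sym; case: eqP; rewrite ?mulr1 ?mulr0.
Qed.

Lemma brick_is_string (M : rmodule A) : brick M ->
  exists i m (ml : (m <= l)%N),
    [/\ (0 < m <= n)%N, full_string i m & rmod_iso (string_mod i ml) M].
Proof.
move=> Mb; have [M0 Minv] := Mb.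
have ex_m : exists m, `[< forall w : M, iter m (T M) w = 0 >].
  by exists l; apply/asboolP => w; exact: (iter_shift_l src_inj tgtE).
case: (ex_minnP ex_m) => m /asboolP Tm m_min.
have ml : (m <= l)%N.
  by apply: m_min; apply/asboolP => w; exact: (iter_shift_l src_inj tgtE).
have m0 : (0 < m)%N.
  rewrite lt0n; apply/eqP => m0; apply: M0; apply/lfunP => v.
  by rewrite id_lfunE lfunE /=; have := Tm v; rewrite m0.
have [u Tu] : exists u : M, iter m.-1 (T M) u <> 0.
  apply: contrapT => /forallNP Tu; have := m_min m.-1.
  have -> : `[< forall w : M, iter m.-1 (T M) w = 0 >] = true.
    by apply/asboolP => w; apply: contrapT; apply: Tu.
  by move=> /(_ isT); lia.
have mn := brick_nilpotency_le Mb Tm Tu.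
have lin k := lfun_of_linear (@iter_shift_linear K n E src tgt l M k).
have [i Ti] : exists i, iter m.-1 (T M) (vact i u) <> 0.
  apply: contrapT => /forallNP Ti; apply: Tu.
  have [F FE] := lin m.-1.
  rewrite -FE -[u](vact_sum u) linear_sum big1 // => i _; rewrite [LHS]FE.
  by apply: contrapT; apply: Ti.
pose v := vact i u.
have iv : vact i v = v by rewrite /v vact_vact eqxx scale1r.
(* A missing arrow before the last position would already make T^(m-1) v vanish. *)
have fi : full_string i m.
  move=> j jm; apply: contrapT => /negP nj; apply: Ti; rewrite -/v.
  have -> : m.-1 = (m.-1 - j.+1 + j.+1)%N by lia.
  rewrite iterD iterS -iv -(vact_iter tgtE) shift_vact0 //; exact: iter_shift0.
have [f [fh fE]] := string_hom src_inj tgtE ml fi iv (Tm v).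
have [k0 vk] : exists k0, (iter m.-1 (T M) v : 'rV_(rmod_dim M)) 0 k0 != 0.
  apply/existsP; rewrite -negb_forall; apply/negP => /forallP v0; apply: Ti.
  by apply/rowP => k; rewrite mxE; apply/eqP; have := v0 k; rewrite ?negbK.
pose c := (iter m.-1 (T M) v : 'rV_(rmod_dim M)) 0 k0.
have c0 : c != 0 by [].
(* A linear form concentrated at the vertex of T^(m-1) v and normalised to be 1 on that vector. *)
pose phi (w : M) : K := c^-1 * (vact (vrot i m.-1) w : 'rV_(rmod_dim M)) 0 k0.
have phiD a b w w' k : phi (iter k (T M) (a *: w + b *: w')) =
    a * phi (iter k (T M) w) + b * phi (iter k (T M) w').
  have [F FE] := lin k.
  have [G GE] := lfun_of_linear (@vact_linear K n E src tgt l M (vrot i m.-1)).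
  rewrite /phi -!GE -!FE !linearD !linearZ !mxE; ring.
have phi_vact u' w : phi (vact u' w) = (u' == vrot i m.-1)%:R * phi w.
  rewrite /phi vact_vact mxE eq_sym; ring.
have phi0 : phi 0 = 0 by rewrite /phi vact0 mxE mulr0.
(* A map into the uniserial module is determined by its last coordinate: coordinate [j] of [g w] is
   the last coordinate of T^(m-1-j) (g w), hence [phi] at T^(m-1-j) w. *)
have [g gE] : exists g : 'Hom(M, string_mod i ml),
    g =1 (fun w => \row_j phi (iter (m.-1 - j) (T M) w)).
  apply: lfun_of_linear => a w w'; apply/rowP => j; rewrite !mxE.
  by rewrite -[w']scale1r phiD scale1r mul1r.
have gent w j : (g w : 'rV_m) 0 j = phi (iter (m.-1 - j) (T M) w) by rewrite gE mxE.
have rot_last (j : 'I_m) : vrot i m.-1 = vrot (vrot i j) (m.-1 - j).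
  by rewrite -vrotD subnKC //; have := ltn_ord j; lia.
have gh : is_rhom g.
  apply/(is_rhomP src_inj tgtE); split=> [u' w|w]; apply/(@rowP _ m) => j.
    rewrite [RHS]string_vact_entry !gent -(vact_iter tgtE) phi_vact.
    by rewrite (rot_last j) (inj_eq (@vrotI _)).
  rewrite [RHS]string_shift_entry // gent -iterSr.
  have [j0|j0] := posnP (j : nat).
    by rewrite j0 subn0 prednK // Tm phi0 big_pred0 // => a; rewrite j0.
  have jm : (j.-1 < m)%N by have : (j < m)%N := ltn_ord j; lia.
  rewrite (big_pred1 (Ordinal jm)) => [|a].
    have jE : (m.-1 - Ordinal jm = (m.-1 - j).+1)%N; last by rewrite gent jE.
    rewrite [nat_of_ord (Ordinal _)]/=.
    by have : (j < m)%N := ltn_ord j; lia.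
  by rewrite -[LHS]/(a.+1 == j)%N -[RHS]/(a == j.-1 :> nat); lia.
(* For [j > 0] the vector T^(m-1-j) v lies at a vertex other than that of [phi], because
   [m <= n]. *)
have gf0 : g (f (string_vec K m 0)) = string_vec K m 0.
  apply/(@rowP _ m) => j; rewrite gent (fE 0) /= -iv -(vact_iter tgtE) phi_vact mxE.
  have [j0|j0] := eqVneq (j : nat) 0.
    rewrite j0 subn0 eqxx mul1r /phi (vact_iter tgtE) iv.
    by rewrite mulVf.
  case: eqP => [/vrot_inj jE|_]; last by rewrite mul0r.
  exfalso; have jm : (j < m)%N := ltn_ord j; move: j0; rewrite -lt0n.
  have : (m.-1 - j = m.-1)%N by (apply: jE; lia).
  lia.
have fgh : is_rhom (g \o f)%VF by move=> w a; rewrite !comp_lfunE fh gh.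
have gfK : cancel f g.
  move=> w; rewrite -[RHS]id_lfunE -comp_lfunE; apply: string_hom_ext => j _.
  rewrite (string_rhomE src_inj fi j fgh) id_lfunE comp_lfunE gf0.
  by rewrite (string_iter_shift K src_inj tgtE ml fi).
exists i, m, ml; split=> //; first by rewrite m0.
(* The right inverse [h] makes [f] surjective, which together with [gfK] gives the other inverse
   law. *)
have [||h [hh fghK _]] := Minv (f \o g)%VF.
- by move=> w a; rewrite !comp_lfunE gh fh.
- move=> /lfunP /(_ v); rewrite comp_lfunE lfunE /=.
  have <- : f (string_vec K m 0) = v by rewrite (fE 0).
  rewrite gfK (fE 0) /= => v0; apply: Ti; rewrite -/v v0; exact: iter_shift0.
exists f, g; split=> // w.
have fghE u' : f (g (h u')) = u' by rewrite -[RHS]id_lfunE -fghK !comp_lfunE.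
by rewrite -[w in LHS]fghE gfK fghE.
Qed.

End BrickClassification.

(** * Semibricks as independent sets of arcs *)

Definition indep_sets (T : finType) (r : rel T) (V : {set T}) : {set {set T}} :=
  [set X in powerset V | [forall x in X, forall y in X, (x != y) ==> ~~ r x y]].

Lemma indep_setsP (T : finType) (r : rel T) (V X : {set T}) :
  reflect (X \subset V /\ {in X &, forall x y, x != y -> ~~ r x y})
    (X \in indep_sets r V).
Proof.
rewrite !inE; apply: (iffP andP) => [[XV /forall_inP h]|[XV h]]; split=> //.
  by move=> x y xX yX; have /forall_inP/(_ y yX)/implyP := h x xX.
by apply/forall_inP => x xX; apply/forall_inP => y yX; apply/implyP; exact: h.
Qed.

Section SemibrickCount.
Variables (K : fieldType) (n : nat) (E : finType) (src tgt : E -> 'I_n).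
Hypothesis src_inj : injective src.
Hypothesis tgtE : forall x, tgt x = ordS (src x).
Variable l : nat.
Notation Q := (Quiver src tgt).
Notation A := (truncated_path_algebra K Q l).
Notation has_arrow := (has_arrow src).
Notation full_string := (full_string src).
Notation string_mod := (string_mod K tgtE).
Notation arc := ('I_n * 'I_(minn n l).+1)%type.

Definition arc_rel (x y : arc) : bool := arc_hom (x.1, x.2 : nat) (y.1, y.2 : nat).

(** The bound [minn n l] on lengths comes from the brick condition and from the truncation, and
    makes the arcs a finite type. That type still contains length 0, which is excluded here. *)
Definition full_arcs : {set arc} := [set x : arc | (0 < x.2)%N &&
  [forall j : 'I_n, (j.+1 < x.2)%N ==> has_arrow (vrot x.1 j)]].

Lemma arc_bounds (x : arc) : (x.2 <= n)%N /\ (x.2 <= l)%N.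
Proof. by have := ltn_ord x.2; lia. Qed.

Lemma full_arcsP (x : arc) :
  reflect ((0 < x.2 <= n)%N /\ full_string x.1 x.2) (x \in full_arcs).
Proof.
have [xn xl] := arc_bounds x.
rewrite inE; apply: (iffP andP) => [[x0 /forallP xf]|[/andP[x0 _] xf]].
  rewrite x0; split=> // j jx; have jn : (j < n)%N by lia.
  by have /implyP := xf (Ordinal jn); apply.
by split=> //; apply/forallP => j; apply/implyP; exact: xf.
Qed.

Definition arc_mod (x : arc) : rmodule A := string_mod x.1 (proj2 (arc_bounds x)).

Lemma arc_mod_iso (x y : arc) : x \in full_arcs -> y \in full_arcs ->
  isoclass (arc_mod x) = isoclass (arc_mod y) -> x = y.
Proof.
move=> /full_arcsP[xn xf] /full_arcsP[yn yf] /isoclass_eqP.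
move=> /(string_iso_arc src_inj xf yf xn yn).
by case: x y {xn xf yn yf} => [a b] [c d] /= [-> /val_inj ->].
Qed.

Definition arc_classes (X : {set arc}) : set (set (rmodule A)) :=
  [set C | exists2 x, x \in X & C = isoclass (arc_mod x)]%classic.

Lemma arc_classes_inj : {in powerset full_arcs &, injective arc_classes}.
Proof.
have sub (X Y : {set arc}) : X \subset full_arcs -> Y \subset full_arcs ->
    arc_classes X = arc_classes Y -> X \subset Y.
  move=> /fintype.subsetP XV /fintype.subsetP YV XY; apply/fintype.subsetP => x xX.
  have : arc_classes X (isoclass (arc_mod x)) by exists x.
  by rewrite XY => -[y yY /(arc_mod_iso (XV _ xX) (YV _ yY)) ->].
move=> X Y; rewrite !inE => XV YV XY; apply/eqP.
by rewrite finset.eqEsubset; apply/andP; split; apply: sub.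
Qed.

Lemma arc_classes_semibrick X : X \in indep_sets arc_rel full_arcs ->
  semibrick (arc_classes X).
Proof.
move=> /indep_setsP[/fintype.subsetP XV Xr]; split.
  move=> C [x xX ->]; exists (arc_mod x) => //.
  by have /full_arcsP[xn xf] := XV x xX; apply: string_mod_brick.
move=> C1 C2 [x xX ->] [y yX ->] xy M1 M2 /= iM1 iM2 f fh.
have [a [a' [ah ah' aK aK']]] := iM1.
have [b [b' [bh bh' bK bK']]] := iM2.
have nxy : x != y by apply/eqP => exy; apply: xy; rewrite exy.
have /full_arcsP[xn xf] := XV x xX; have /full_arcsP[/andP[_ yn] yf] := XV y yX.
have h0 : (b' \o (f \o a))%VF = 0 :> 'Hom(arc_mod x, arc_mod y).
  apply: (string_rhom0 src_inj xf yf yn); first exact: Xr.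
  by move=> v c; rewrite !comp_lfunE ah fh bh'.
apply/lfunP => v; rewrite lfunE /= -[f v]bK' -[v]aK'.
have := congr1 (fun g : 'Hom(_, _) => g (a' v)) h0; rewrite !comp_lfunE => ->.
by rewrite lfunE /= linear0.
Qed.

Lemma semibrick_arc_classes (S : set (set (rmodule A))) : semibrick S ->
  exists2 X, X \in indep_sets arc_rel full_arcs & S = arc_classes X.
Proof.
move=> [Sb Sh]; pose X := [set x in full_arcs | `[< S (isoclass (arc_mod x)) >]].
have inX x : (x \in X) = (x \in full_arcs) && `[< S (isoclass (arc_mod x)) >].
  by rewrite [LHS]inE.
exists X.
  apply/indep_setsP; split; first by apply/fintype.subsetP => x; rewrite inX => /andP[].
  move=> x y; rewrite !inX => /andP[xV /asboolP xS] /andP[yV /asboolP yS] nxy.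
  apply/negP => hxy.
  have /full_arcsP[/andP[x0 xn] xf] := xV; have /full_arcsP[/andP[_ yn] yf] := yV.
  have [f fh f0] := string_rhom_neq0 K src_inj tgtE
    (proj2 (arc_bounds x)) (proj2 (arc_bounds y)) xf yf hxy x0.
  apply: f0; apply: (Sh _ _ xS yS _ _ _ _ _ f fh).
  - by move=> /(arc_mod_iso xV yV) /eqP; rewrite (negPf nxy).
  - exact: rmod_iso_refl.
  - exact: rmod_iso_refl.
apply/seteqP; split=> C; last by move=> [x]; rewrite inX => /andP[_ /asboolP ?] ->.
move=> SC; have [M Mb CE] := Sb C SC.
have [i [m [ml [mn mf miso]]]] := brick_is_string src_inj tgtE Mb.
have mlt : (m < (minn n l).+1)%N by lia.
pose x : arc := (i, Ordinal mlt).
have xC : C = isoclass (arc_mod x).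
  rewrite CE; apply/isoclass_eqP; apply: rmod_iso_sym.
  by rewrite /arc_mod /= (bool_irrelevance (proj2 _) ml).
exists x => //; rewrite inX; apply/andP; split; first by apply/full_arcsP.
by apply/asboolP; rewrite -xC.
Qed.

Lemma semibricks_image : [set S | @semibrick K A S]%classic =
  (arc_classes @` [set X | X \in indep_sets arc_rel full_arcs])%classic.
Proof.
apply/seteqP; split=> [S /semibrick_arc_classes [X XI ->]|S [X XI <-]] /=.
  by exists X.
exact: arc_classes_semibrick.
Qed.

(** This makes [num_semibricks] a true cardinality, since [fset_set] is empty on infinite sets. *)
Lemma finite_semibricks : finite_set [set S | @semibrick K A S]%classic.
Proof. by rewrite semibricks_image; apply: finite_image; exact: finite_finset. Qed.

Lemma num_semibricks_indep : num_semibricks A = #|indep_sets arc_rel full_arcs|.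
Proof.
rewrite /num_semibricks semibricks_image fset_set_image; last exact: finite_finset.
set I := indep_sets _ _.
have -> : fset_set [set X | X \in I]%classic = [fset X in I]%fset.
  apply/fsetP => X; rewrite in_fset_set; last exact: finite_finset.
  rewrite mem_setE in_fset.
  by [].
rewrite card_in_imfset ?card_finset // => X Y /=; rewrite !inE.
by move=> /andP[XV _] /andP[YV _]; apply: arc_classes_inj; rewrite inE.
Qed.

End SemibrickCount.

(** * Counting the independent sets of a relation *)

Section IndependentSets.
Variables (T : finType) (r : rel T).
Implicit Types V W X Y : {set T}.

Lemma indep_sets0 : #|indep_sets r finset.set0| = 1%N.
Proof.
rewrite -(cards1 (finset.set0 : {set T})); apply: eq_card => X; rewrite [RHS]inE.
apply/indep_setsP/eqP => [[]|->]; first by rewrite finset.subset0 => /eqP.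
by split=> [|x y]; rewrite ?sub0set ?inE.
Qed.

Lemma card_indep_image (T' : finType) (r' : rel T') (f : T -> T') V :
  {in V &, injective f} -> {in V &, forall x y, r' (f x) (f y) = r x y} ->
  #|indep_sets r' (f @: V)| = #|indep_sets r V|.
Proof.
move=> f_inj fr.
have imI X : X \in indep_sets r V -> f @: X \in indep_sets r' (f @: V).
  move=> /indep_setsP[XV Xr]; apply/indep_setsP; split; first exact: imsetS.
  move=> _ _ /imsetP[x xX ->] /imsetP[y yX ->] fxy.
  rewrite fr ?(fintype.subsetP XV) //; apply: Xr => //.
  by apply: contraNneq fxy => ->.
have -> : indep_sets r' (f @: V) = (fun X : {set T} => f @: X) @: indep_sets r V.
  apply/eqP; rewrite finset.eqEsubset; apply/andP; split; apply/fintype.subsetP => Y.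
    move=> /indep_setsP[YV Yr]; apply/imsetP; exists (V :&: f @^-1: Y).
      apply/indep_setsP; split; first exact: finset.subsetIl.
      move=> x y; rewrite !inE => /andP[xV xY] /andP[yV yY] xy.
      by rewrite -fr // Yr //; apply: contraNneq xy => /f_inj -> //.
    apply/setP => y; apply/idP/imsetP => [yY|[x]]; last first.
      by rewrite !inE => /andP[_ xY] ->.
    have /imsetP[x xV yE] := fintype.subsetP YV y yY.
    by exists x; rewrite // !inE xV -yE.
  by move=> /imsetP[X XI ->]; exact: imI.
apply: card_in_imset => X Y /indep_setsP[XV _] /indep_setsP[YV _] XY.
have sub (Z Z' : {set T}) : Z \subset V -> Z' \subset V -> f @: Z = f @: Z' -> Z \subset Z'.
  move=> /fintype.subsetP ZV /fintype.subsetP ZV' e; apply/fintype.subsetP => x xZ.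
  have : f x \in f @: Z' by rewrite -e imset_f.
  by move=> /imsetP[y yZ /f_inj ->] //; [apply: ZV | apply: ZV'].
by apply/eqP; rewrite finset.eqEsubset; apply/andP; split; apply: sub.
Qed.

Lemma card_indepU V W : [disjoint V & W] ->
  (forall x y, x \in V -> y \in W -> ~~ r x y && ~~ r y x) ->
  #|indep_sets r (V :|: W)| = (#|indep_sets r V| * #|indep_sets r W|)%N.
Proof.
move=> VW rVW; rewrite -cardsX.
pose g (P : {set T} * {set T}) := P.1 :|: P.2.
have -> : indep_sets r (V :|: W) = g @: finset.setX (indep_sets r V) (indep_sets r W).
  apply/setP => X; apply/indep_setsP/imsetP => [[XVW Xr]|[[X1 X2]]]; last first.
    rewrite finset.in_setX /= => /andP[/indep_setsP[XV XrV] /indep_setsP[XW XrW]] ->.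
    split; first exact: finset.setUSS.
    rewrite /g /= => x y; rewrite !inE => /orP[xX|xX] /orP[yX|yX] xy.
    - exact: XrV.
    - by have /andP[] := rVW _ _ (fintype.subsetP XV _ xX) (fintype.subsetP XW _ yX).
    - by have /andP[] := rVW _ _ (fintype.subsetP XV _ yX) (fintype.subsetP XW _ xX).
    - exact: XrW.
  exists (X :&: V, X :&: W); last by rewrite /g /= -finset.setIUr; apply/esym/finset.setIidPl.
  rewrite finset.in_setX /=; apply/andP; split; apply/indep_setsP; split.
  - exact: finset.subsetIr.
  - by move=> x y; rewrite !inE => /andP[? _] /andP[? _]; exact: Xr.
  - exact: finset.subsetIr.
  - by move=> x y; rewrite !inE => /andP[? _] /andP[? _]; exact: Xr.
apply: card_in_imset => -[X1 X2] [Y1 Y2]; rewrite !finset.in_setX /= /g /=.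
move=> /andP[/indep_setsP[XV _] /indep_setsP[XW _]].
move=> /andP[/indep_setsP[YV _] /indep_setsP[YW _]] e.
have cap (Z1 Z2 : {set T}) : Z1 \subset V -> Z2 \subset W ->
    Z1 = (Z1 :|: Z2) :&: V /\ Z2 = (Z1 :|: Z2) :&: W.
  move=> /fintype.subsetP ZV /fintype.subsetP ZW.
  split; apply/setP => x; rewrite !inE.
    apply/idP/andP => [xZ|[/orP[//|/ZW xW] xV]]; first by rewrite xZ ZV.
    by have := disjointFr VW xV; rewrite xW.
  apply/idP/andP => [xZ|[/orP[/ZV xV|//] xW]]; first by rewrite xZ orbT ZW.
  by have := disjointFr VW xV; rewrite xW.
have [d1 d2] := cap _ _ XV XW; have [e1 e2] := cap _ _ YV YW.
by congr pair; [rewrite [LHS]d1 [RHS]e1 e | rewrite [LHS]d2 [RHS]e2 e].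
Qed.

Variables (c : pred T) (len : T -> nat).

(** For arcs, [c] means passing through vertex 0 and [len] is the length. The inequality is strict,
    so that at most one [x] with [c x] qualifies. *)
Definition longest (x : T) (X : {set T}) :=
  (x \in X) && [forall y in X, (c y && (y != x)) ==> (len y < len x)%N].

Definition below (x : T) V : {set T} :=
  [set y in V | [&& y != x, ~~ r x y, ~~ r y x & ~~ (c y && (len x <= len y)%N)]].

Lemma card_indep_longest V x : x \in V ->
  #|[set X in indep_sets r V | longest x X]| = #|indep_sets r (below x V)|.
Proof.
move=> xV.
have -> : [set X in indep_sets r V | longest x X] =
    (fun X : {set T} => x |: X) @: indep_sets r (below x V).
  apply/setP => X; rewrite inE; apply/andP/imsetP.
    move=> [/indep_setsP[XV Xr] /andP[xX /forall_inP Xl]].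
    exists (X :\ x); last by rewrite finset.setD1K.
    apply/indep_setsP; split; last first.
      by move=> y z; rewrite !inE => /andP[_ ?] /andP[_ ?]; exact: Xr.
    apply/fintype.subsetP => y; rewrite !inE => /andP[yx yX].
    rewrite (fintype.subsetP XV) // yx !Xr //=; last by rewrite eq_sym.
    apply/negP => /andP[cy ly]; have /implyP := Xl y yX.
    by rewrite cy yx => /(_ isT); rewrite ltnNge ly.
  move=> [Y /indep_setsP[/fintype.subsetP YV Yr] ->]; split.
    apply/indep_setsP; split.
      apply/fintype.subsetP => y; rewrite !inE => /orP[/eqP -> //|/YV].
      by rewrite inE => /andP[].
    move=> y z; rewrite !inE => /orP[/eqP ->|yY] /orP[/eqP ->|zY] yz.
    - by rewrite eqxx in yz.
    - by have := YV z zY; rewrite inE => /and5P[].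
    - by have := YV y yY; rewrite inE => /and5P[].
    - exact: Yr.
  rewrite /longest setU11 /=; apply/forall_inP => y; rewrite !inE.
  move=> /orP[/eqP ->|yY]; first by rewrite eqxx andbF.
  apply/implyP => /andP[cy yx]; have := YV y yY; rewrite inE => /and5P[_ _ _ _].
  by rewrite cy /= -ltnNge.
apply: card_in_imset => X Y /indep_setsP[/fintype.subsetP XV _].
move=> /indep_setsP[/fintype.subsetP YV _] /(congr1 (fun Z : {set T} => Z :\ x)) /=.
rewrite !finset.setU1K //; apply/negP.
- by move=> /YV; rewrite inE eqxx andbF.
- by move=> /XV; rewrite inE eqxx andbF.
Qed.

(** The independent sets are sorted by their longest member satisfying [c], if any; the hypothesis
    on [len] excludes ties, so that member is unique. *)
Lemma card_indep_split V :
  {in V &, forall x y, c x -> c y -> x != y -> ~~ r x y -> ~~ r y x -> len x != len y} ->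
  #|indep_sets r V| = (#|indep_sets r [set x in V | ~~ c x]| +
    \sum_(x in V | c x) #|indep_sets r (below x V)|)%N.
Proof.
move=> lenV; set I := indep_sets r V.
have -> : indep_sets r [set x in V | ~~ c x] = [set X in I | [forall x in X, ~~ c x]].
  apply/setP => X; rewrite inE.
  apply/indep_setsP/andP => [[/fintype.subsetP XV Xr]|[/indep_setsP[XV Xr] /forall_inP Xc]].
    split; last by apply/forall_inP => x /XV; rewrite inE => /andP[].
    apply/indep_setsP; split=> //; apply/fintype.subsetP => x /XV.
    by rewrite inE => /andP[].
  by split=> //; apply/fintype.subsetP => x xX; rewrite inE Xc // (fintype.subsetP XV).
have -> : (\sum_(x in V | c x) #|indep_sets r (below x V)| =
    \sum_(x in V | c x) \sum_(X in I) longest x X)%N.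
  apply: eq_bigr => x /andP[xV _]; rewrite -card_indep_longest // -sum1_card.
  by rewrite -big_mkcondr; apply: eq_bigl => X; rewrite inE.
have -> : #|[set X in I | [forall x in X, ~~ c x]]| =
    (\sum_(X in I) [forall x in X, ~~ c x])%N.
  by rewrite -sum1_card -big_mkcondr; apply: eq_bigl => X; rewrite inE.
rewrite exchange_big /= -big_split /= -sum1_card; apply: eq_bigr => X /indep_setsP[XV Xr].
have [/forall_inP Xc|] := boolP [forall x in X, ~~ c x].
  rewrite big1 // => x /andP[xV cx]; rewrite /longest.
  by case: (boolP (x \in X)) => //= /Xc; rewrite cx.
rewrite negb_forall_in => /exists_inP[x0 x0X]; rewrite negbK => cx0.
have x0P : (x0 \in X) && c x0 by rewrite x0X.
case: (@arg_maxnP _ x0 (fun x => (x \in X) && c x) len x0P) => x /andP[xX cx] x_max.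
rewrite add0n (bigD1 x) /=; last by rewrite (fintype.subsetP XV).
have -> : longest x X.
  rewrite /longest xX /=.
  apply/forall_inP => y yX; apply/implyP => /andP[cy yx].
  rewrite ltn_neqAle [(_ <= _)%N]x_max /= ?yX // andbT.
  by apply: lenV; rewrite ?(fintype.subsetP XV) //; apply: Xr; rewrite // eq_sym.
rewrite big1 // => y /andP[/andP[yV cy] yx]; rewrite /longest.
case: (boolP (y \in X)) => //= yX; case: forall_inP => // /(_ x xX).
by rewrite cx eq_sym yx ltnNge /=; have := x_max y; rewrite /= yX => /(_ cy) ->.
Qed.

End IndependentSets.

(** * Arcs on the circle and on the line *)

Lemma arc_diff_vrot n (i : 'I_n) a b : (a < n)%N -> (b < n)%N ->
  arc_diff (vrot i a) (vrot i b) = (if b <= a then a - b else a + n - b)%N.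
Proof.
move=> an bn; apply/esym/vrot_eq; first by case: ifP; lia.
rewrite -vrotD; case: ifP => ba; first by rewrite subnKC.
by rewrite subnKC; [rewrite addnC vrotD vrot_n | lia].
Qed.

(** Referring all distances to one base vertex [i] turns relations between arcs into linear
    inequalities. *)
Lemma arc_diff_base n (i j k : 'I_n) : arc_diff j k =
  (if arc_diff k i <= arc_diff j i then arc_diff j i - arc_diff k i
   else arc_diff j i + n - arc_diff k i)%N.
Proof. by rewrite -(arc_diff_vrot i) ?arc_diff_lt // !vrot_arc_diff. Qed.

Section ArcCount.
Variable l : nat.
Notation arc n := ('I_n * 'I_(minn n l).+1)%type.

Definition lin_arcs n : {set arc n} := [set x : arc n | 0 < x.2 & x.1 + x.2 <= n]%N.
Definition all_arcs n : {set arc n} := [set x : arc n | 0 < x.2]%N.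

Definition lin_count n := #|indep_sets (@arc_rel n l) (lin_arcs n)|.
Definition cyc_count n := #|indep_sets (@arc_rel n l) (all_arcs n)|.

(** The arcs inside a segment of [k] vertices starting at [p], which is a copy of the line with [k]
    vertices. *)
Definition window n (p : 'I_n) k : {set arc n} :=
  [set x : arc n | 0 < x.2 & arc_diff x.1 p + x.2 <= k]%N.

Lemma lin_count0 : lin_count 0 = 1%N.
Proof.
rewrite /lin_count -(indep_sets0 (@arc_rel 0 l)); congr #|indep_sets _ _|.
by apply/setP => -[[]].
Qed.

Lemma card_window n (p : 'I_n) k : (k <= n)%N ->
  #|indep_sets (@arc_rel n l) (window p k)| = lin_count k.
Proof.
move=> kn.
have wd : ((minn k l).+1 <= (minn n l).+1)%N by lia.
pose f (x : arc k) : arc n := (vrot p x.1, widen_ord wd x.2).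
have -> : window p k = f @: lin_arcs k.
  apply/setP => -[j m]; apply/idP/imsetP => [|[[a b]]]; last first.
    rewrite !inE /= => /andP[b0 ab] [-> ->] /=; rewrite b0 /=.
    have an : (a < n)%N by have := ltn_ord a; lia.
    have p0 : p = vrot p 0 by [].
    by rewrite {2}p0 arc_diff_vrot //=; lia.
  rewrite inE /= => /andP[m0 jm].
  have ak : (arc_diff j p < k)%N by lia.
  have mk : (m < (minn k l).+1)%N by have := ltn_ord m; lia.
  exists (Ordinal ak, Ordinal mk); first by rewrite inE /= m0.
  by congr pair; [rewrite /= vrot_arc_diff | apply: val_inj].
apply: card_indep_image.
  move=> [a b] [c d] _ _ [/vrot_inj ac bd].
  congr pair; apply: val_inj => //=; apply: ac; [have := ltn_ord a | have := ltn_ord c]; lia.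
move=> [a b] [c d]; rewrite !inE /= => /andP[b0 ab] /andP[d0 cd].
rewrite /arc_rel /arc_hom /= arc_diff_vrot ?(leq_trans (ltn_ord _)) //.
(* If [a < c] the distances modulo [k] and modulo [n] differ, but both are at least the target
   length [d], so neither circle has a relation. *)
rewrite /arc_diff; case: ifP => // ac; lia.
Qed.

Definition covers0 n (x : arc n.+1) : bool := (arc_diff ord0 x.1 < x.2)%N.

Lemma mem_window n (i : 'I_n) p k (y : arc n) : (p + k <= n)%N ->
  (y \in window (vrot i p) k) =
  [&& 0 < y.2, p <= arc_diff y.1 i & arc_diff y.1 i + y.2 <= p + k]%N.
Proof.
move=> pkn; rewrite inE; case: (ltnP 0 y.2) => //= y0.
have an := arc_diff_lt y.1 i.
(* If [p = n] the window is empty; this occurs outside an arc that runs round the whole circle. *)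
have [pn|pn] := leqP n p.
  have -> : p = n by lia.
  rewrite vrot_n; lia.
rewrite -{1}(vrot_arc_diff y.1 i) arc_diff_vrot //; case: ifP; lia.
Qed.

(* The first factor counts the arcs strictly inside x, the second those disjoint from x. *)
Lemma below_arc n (x : arc n.+1) (V : {set arc n.+1}) :
  V = all_arcs n.+1 \/ V = lin_arcs n.+1 -> x \in V -> covers0 x ->
  #|indep_sets (@arc_rel _ l) (below (@arc_rel _ l) (@covers0 n) (fun y => y.2 : nat) x V)| =
  (lin_count (x.2 - 2) * lin_count (n.+1 - x.2))%N.
Proof.
move=> hV xV cx; have [x2n _] := arc_bounds x.
have x20 : (0 < x.2)%N by case: hV xV => -> ; rewrite inE => // /andP[].
(* The inner window leaves out both end vertices of [x]. For [x.2 = 1] truncated subtraction makes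
   it empty, as it should be. *)
rewrite -(@card_window _ (vrot x.1 1)); last by lia.
rewrite -(@card_window _ (vrot x.1 x.2)); last by lia.
have w1 : (1 + (x.2 - 2) <= n.+1)%N by lia.
have w2 : (x.2 + (n.+1 - x.2) <= n.+1)%N by lia.
rewrite -card_indepU; last first.
- move=> y w; rewrite !mem_window // /arc_rel /arc_hom /=.
  rewrite (arc_diff_base x.1 y.1 w.1) (arc_diff_base x.1 w.1 y.1).
  have := arc_diff_lt y.1 x.1; have := arc_diff_lt w.1 x.1.
  move: (arc_diff y.1 x.1) (arc_diff w.1 x.1) => a a' aN aN' /and3P[? ? ?] /and3P[? ? ?].
  by do 2!case: ifP => ?; lia.
- rewrite disjoint_subset; apply/fintype.subsetP => y.
  by rewrite -[y \in predC _]/(y \notin _) !mem_window //; lia.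
congr #|indep_sets _ _|.
apply/setP => y; rewrite [RHS]inE !mem_window // [LHS]inE /arc_rel /arc_hom /covers0 /=.
have yx : (y != x) = (arc_diff y.1 x.1 != 0%N) || (y.2 != x.2 :> nat).
  rewrite -negb_and; congr negb; apply/eqP/andP => [->|[/eqP d /eqP e]].
    by rewrite /arc_diff leqnn subnn.
  case: y x d e {hV xV cx x2n x20 w1 w2} => [a b] [c d] /= ac bd; congr pair; last exact: val_inj.
  by rewrite -[LHS](vrot_arc_diff a c) ac.
rewrite yx (arc_diff_base x.1 x.1 y.1) (arc_diff_base x.1 ord0 y.1).
have xx : arc_diff x.1 x.1 = 0%N by rewrite /arc_diff leqnn subnn.
rewrite xx; have := arc_diff_lt y.1 x.1; have := arc_diff_lt ord0 x.1.
have y2n : (y.2 <= n.+1)%N by have [] := arc_bounds y.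
move: cx; rewrite /covers0; case: hV xV => ->; rewrite !inE.
  move: (arc_diff y.1 x.1) (arc_diff ord0 x.1) => a z _ zx zN aN.
  by do 2!case: ifP => ?; lia.
move=> /andP[_ xl] cx _.
(* On the line an arc through vertex 0 has to start there. *)
have x1 : x.1 = 0%N :> nat.
  by move: cx; rewrite /arc_diff /=; have := ltn_ord x.1; case: ifP; lia.
have -> : arc_diff ord0 x.1 = 0%N by rewrite /arc_diff x1.
have -> : arc_diff y.1 x.1 = y.1 by rewrite /arc_diff x1 subn0.
move: y2n x20 x2n; move: (nat_of_ord y.1) (nat_of_ord y.2) (nat_of_ord x.2) => a k m km m0 mN aN.
by case: ifP => ?; lia.
Qed.

End ArcCount.

Section ArcRecurrences.
Variable l : nat.
Notation arc n := ('I_n * 'I_(minn n l).+1)%type.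

(** Arcs through a common vertex with no map either way are strictly nested; this rules out ties for
    the longest. *)
Lemma covering_arcs_len n (x y : arc n.+1) : (0 < x.2)%N -> (0 < y.2)%N ->
  covers0 x -> covers0 y -> ~~ arc_rel x y -> ~~ arc_rel y x -> x.2 != y.2 :> nat.
Proof.
rewrite /covers0 /arc_rel /arc_hom /= (arc_diff_base y.1 ord0 x.1).
rewrite (arc_diff_base y.1 y.1 x.1).
have -> : arc_diff y.1 y.1 = 0%N by rewrite /arc_diff leqnn subnn.
have := arc_diff_lt ord0 y.1; have := arc_diff_lt x.1 y.1.
move: (arc_diff ord0 y.1) (arc_diff x.1 y.1) (nat_of_ord x.2) (nat_of_ord y.2).
move=> d s m k sN dN m0 k0; by case: ifP => ?; case: ifP => ?; lia.
Qed.

Lemma card_indep_arcs n (V : {set arc n.+1}) :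
  V = all_arcs l n.+1 \/ V = lin_arcs l n.+1 ->
  #|indep_sets (@arc_rel _ l) V| = (lin_count l n +
    \sum_(x in V | covers0 x) lin_count l (x.2 - 2) * lin_count l (n.+1 - x.2))%N.
Proof.
move=> hV; rewrite (@card_indep_split _ _ (@covers0 l n) (fun x => x.2 : nat)); last first.
  have V0 x : x \in V -> (0 < x.2)%N by case: hV => ->; rewrite inE => // /andP[].
  by move=> x y xV yV cx cy _; apply: covering_arcs_len => //; exact: V0.
congr (_ + _)%N; last by apply: eq_bigr => x /andP[xV cx]; exact: below_arc.
(* Arcs avoiding vertex 0 lie in the segment of the other [n] vertices, so circle and line give the
   same count. *)
rewrite -(@card_window l _ (vrot ord0 1) n (leqnSn n)); congr #|indep_sets _ _|.
apply/setP => y; rewrite mem_window // inE /covers0.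
have [y2n _] := arc_bounds y; have := ltn_ord y.1.
have -> : arc_diff ord0 y.1 = (if y.1 == 0%N :> nat then 0 else n.+1 - y.1)%N.
  by rewrite /arc_diff /=; case: ifP; case: eqP; lia.
have -> : arc_diff y.1 ord0 = y.1 by rewrite /arc_diff /= subn0.
case: hV => ->; rewrite !inE; move: y2n; move: (nat_of_ord y.1) (nat_of_ord y.2) => a k kn an.
  by case: eqP => ?; lia.
by case: eqP => ?; lia.
Qed.

Lemma arc_sum n (P : pred (arc n)) (g : nat -> nat) :
  (\sum_(x : arc n | P x) g x.2 =
   \sum_(m < (minn n l).+1) (\sum_(i < n) P (i, m)) * g m)%N.
Proof.
rewrite big_mkcond.
transitivity (\sum_(p : arc n) (if P (p.1, p.2) then g p.2 else 0))%N.
  by apply: eq_bigr => -[].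
rewrite -(pair_bigA _ (fun (i : 'I_n) (m : 'I_(minn n l).+1) =>
  if P (i, m) then g m else 0%N)) /= exchange_big; apply: eq_bigr => m _; rewrite big_distrl /=.
by apply: eq_bigr => i _; case: P; rewrite ?mul1n ?mul0n.
Qed.

Lemma sum_ltn_ord n m : (m <= n)%N -> (\sum_(i < n) (i < m) = m)%N.
Proof.
move=> mn; transitivity (\sum_(i < n | (i < m)%N) 1)%N; first by rewrite [RHS]big_mkcond.
by rewrite (big_ord_narrow mn) sum1_card card_ord.
Qed.

(** The distance to vertex 0 is a bijective function of the starting point. This is the origin of
    the factor [m] on the circle. *)
Lemma sum_covers0 n m : (m <= n.+1)%N -> (\sum_(i < n.+1) (arc_diff ord0 i < m) = m)%N.
Proof.
move=> mn; rewrite -[RHS](sum_ltn_ord mn).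
pose f i : 'I_n.+1 := Ordinal (arc_diff_lt ord0 i).
rewrite [RHS](reindex_inj (h := f)) // => i j /(congr1 val) /= ij.
apply: (@vrotI _ (arc_diff ord0 j)).
by rewrite -{1}ij !vrot_arc_diff.
Qed.

Lemma lin_count_rec n : lin_count l n.+1 = (lin_count l n +
  \sum_(1 <= m < (minn n.+1 l).+1) lin_count l (m - 2) * lin_count l (n.+1 - m))%N.
Proof.
rewrite /lin_count (card_indep_arcs (or_intror erefl)) -/(lin_count l n); congr (_ + _)%N.
rewrite (arc_sum _ (fun m => lin_count l (m - 2) * lin_count l (n.+1 - m))%N).
rewrite big_add1 big_mkord big_ord_recl [X in (X * _)%N]big1 => [|i _]; last by rewrite inE.
rewrite add0n; apply: eq_bigr => m _; rewrite -[RHS]mul1n; congr (_ * _)%N.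
rewrite big_ord_recl [X in (_ + X)%N]big1 => [|i _]; last first.
  rewrite inE /covers0 /arc_diff /=.
  have := ltn_ord m; have := ltn_ord i; rewrite /bump /=; lia.
rewrite inE /covers0 /arc_diff /=; have := ltn_ord m; rewrite /bump /=; lia.
Qed.

Lemma cyc_count_rec n : cyc_count l n.+1 = (lin_count l n +
  \sum_(1 <= m < (minn n.+1 l).+1) m * (lin_count l (m - 2) * lin_count l (n.+1 - m)))%N.
Proof.
rewrite /cyc_count (card_indep_arcs (or_introl erefl)) -/(lin_count l n); congr (_ + _)%N.
rewrite (arc_sum _ (fun m => lin_count l (m - 2) * lin_count l (n.+1 - m))%N).
rewrite big_add1 big_mkord big_ord_recl [X in (X * _)%N]big1 => [|i _]; last by rewrite inE.
rewrite add0n; apply: eq_bigr => m _; congr (_ * _)%N.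
have mn : (m.+1 <= n.+1)%N by have := ltn_ord m; lia.
rewrite -[RHS](sum_covers0 mn); apply: eq_bigr => i _.
by rewrite inE /covers0 /= /bump add1n.
Qed.

End ArcRecurrences.

(** * Catalan numbers and the recurrences *)

(** The division is exact because [n.+1] is coprime to [n] and divides [n * 'C(n.*2, n)]. *)
Lemma catalan_mul n : (n.+1 * catalan n = 'C(n.*2, n))%N.
Proof.
rewrite /catalan mulnC divnK // -(@Gauss_dvdr _ n); last exact: coprimeSn.
have -> : (n * 'C(n.*2, n) = n.+1 * 'C(n.*2, n.+1))%N.
  by rewrite mul_bin_left -addnn addnK.
exact: dvdn_mulr.
Qed.

Lemma catalanS n : (n.+2 * catalan n.+1 = (4 * n + 2) * catalan n)%N.
Proof.
have e : (n.*2.+1 * 'C(n.*2, n) = n.+1 * 'C(n.*2.+1, n))%N.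
  by have := mul_bin_down n.*2.+1 n; rewrite /= => ->; congr (_ * _)%N; lia.
have e' : (n.*2.+2 * 'C(n.*2.+1, n) = n.+1 * 'C(n.+1.*2, n.+1))%N.
  by rewrite mul_bin_diag.
apply/eqP; rewrite -(eqn_pmul2l (ltn0Sn n)); apply/eqP.
rewrite catalan_mul -e'.
have -> : (n.*2.+2 * 'C(n.*2.+1, n) = 2 * (n.+1 * 'C(n.*2.+1, n)))%N.
  by rewrite mulnA; congr (_ * _)%N; lia.
rewrite -e -catalan_mul !mulnA; congr (_ * _)%N; nia.
Qed.

Lemma catalan0 : catalan 0 = 1%N.
Proof. by []. Qed.

Definition segner_sum n := (\sum_(i < n.+1) catalan i * catalan (n - i))%N.

(** Exchanging [i] and [n - i] pairs the weights [i + 1] and [n - i + 1], which add up to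
    [n + 2]. *)
Lemma segner_sum_weighted n :
  (2 * (\sum_(i < n.+1) i.+1 * (catalan i * catalan (n - i))) = n.+2 * segner_sum n)%N.
Proof.
rewrite mul2n -addnn {2}(reindex_inj rev_ord_inj) /= -big_split /= /segner_sum big_distrr.
apply: eq_bigr => i _ /=; have := ltn_ord i; rewrite subSS => iS.
have -> : (n - (n - i) = i)%N by lia.
by rewrite [X in (_ + _ * X)%N]mulnC -mulnDl; congr (_ * _)%N; lia.
Qed.

(** Generating functions are avoided: inserting [catalanS] termwise into the weighted sum yields a
    first-order recurrence for [segner_sum], the one that the Catalan numbers satisfy. *)
Lemma segner_catalan n : segner_sum n = catalan n.+1.
Proof.
elim: n => [|n IHn]; first by rewrite /segner_sum big_ord_recl big_ord0.
have hS : (n.+3 * segner_sum n.+1 = 2 * catalan n.+1 + 4 * (n.+1 * segner_sum n))%N.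
  rewrite -segner_sum_weighted big_ord_recl /= mul1n subn0 catalan0 mul1n mulnDr.
  congr (_ + _)%N.
  have -> : (\sum_(i < n.+1) (bump 0 i).+1 * (catalan (bump 0 i) * catalan (n.+1 - bump 0 i)) =
      \sum_(i < n.+1) (4 * i + 2) * catalan i * catalan (n - i))%N.
    by apply: eq_bigr => i _; rewrite /bump add1n mulnA catalanS subSS.
  have := segner_sum_weighted n; set R := (\sum_(i < n.+1) _ * _ * _)%N.
  have : (2 * (2 * \sum_(i < n.+1) i.+1 * (catalan i * catalan (n - i))) =
      R + 2 * segner_sum n)%N.
    rewrite /R /segner_sum !big_distrr -big_split /=.
    by apply: eq_bigr => i _; ring.
  nia.
have cS := catalanS n.+1; rewrite IHn in hS.
apply/eqP; rewrite -(eqn_pmul2l (ltn0Sn n.+2)) hS; apply/eqP; rewrite cS; nia.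
Qed.

(* weight 1 = 2 and weight i = c_(i-1) for i >= 2. *)
Definition weight i := (catalan (i - 1) + (i == 1))%N.

(* [f (k - i)], read as zero at negative arguments. *)
Definition lag (f : nat -> nat) k i := (if i <= k then f (k - i) else 0)%N.

Lemma big_nat_minn l n (F : nat -> nat) :
  (\sum_(1 <= m < (minn n l).+1) F m =
   \sum_(1 <= m < l.+1) (if m <= n then F m else 0))%N.
Proof.
have ml : ((minn n l).+1 <= l.+1)%N by lia.
rewrite (big_nat_widen _ _ _ _ _ ml) /= big_mkcond; apply: eq_big_nat => m /andP[_ mll].
by congr (if _ then _ else _); lia.
Qed.

Lemma weight_sum l (F : nat -> nat) : (0 < l)%N -> (\sum_(1 <= i < l.+1) weight i * F i =
  F 1 + \sum_(1 <= i < l.+1) catalan (i - 1) * F i)%N.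
Proof.
move=> l_gt0.
under eq_bigr => i _ do rewrite /weight mulnDl.
rewrite big_split /= addnC; congr (_ + _)%N.
rewrite big_ltn // eqxx mul1n big_nat big1 ?addn0 // => i i1.
by have -> : (i == 1%N) = false by lia.
Qed.

Section CountRecurrences.
Variables (l : nat) (a b : nat -> nat).
Hypothesis l_gt0 : (0 < l)%N.
Hypothesis a0 : a 0 = 1%N.
Hypothesis aS : forall n, a n.+1 =
  (a n + \sum_(1 <= m < (minn n.+1 l).+1) a (m - 2) * a (n.+1 - m))%N.
Hypothesis bS : forall n, b n.+1 =
  (a n + \sum_(1 <= m < (minn n.+1 l).+1) m * (a (m - 2) * a (n.+1 - m)))%N.

Lemma lin_catalan n : (n <= l)%N -> a n = catalan n.+1.
Proof.
elim/ltn_ind: n => -[|n] IHn nl; first by rewrite a0.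
rewrite aS IHn //; last by lia.
have -> : minn n.+1 l = n.+1 by lia.
have -> : (\sum_(1 <= m < n.+2) a (m - 2) * a (n.+1 - m) =
    \sum_(i < n.+1) catalan i * catalan (n.+1 - i))%N.
  rewrite big_add1 big_mkord; apply: eq_bigr => i _; have iS := ltn_ord i.
  rewrite [a (n.+1 - _)]IHn; [|lia|lia].
  have -> : (n.+1 - i.+1).+1 = (n.+1 - i)%N by lia.
  congr (_ * _)%N; case: (nat_of_ord i) iS => [|j] jn; first by rewrite a0.
  have -> : (j.+2 - 2 = j)%N by lia.
  by apply: IHn; lia.
by rewrite -[RHS]segner_catalan /segner_sum [RHS]big_ord_recr /= subnn catalan0 muln1 addnC.
Qed.

(** The inside of an arc is shorter than [l], hence in the Catalan range. At [i = 1] truncated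
    subtraction gives [a 0 = 1], which is also c_0. *)
Lemma lin_inner i : (0 < i <= l)%N -> a (i - 2) = catalan (i - 1).
Proof.
move=> il; rewrite lin_catalan; last by lia.
have [->//|i1] := eqVneq i 1%N.
by congr catalan; lia.
Qed.

(** The isolated term [a n] merges with the term of length 1, which is why [weight 1] is 2. *)
Lemma lin_weight n : a n.+1 = (\sum_(1 <= i < l.+1) weight i * lag a n.+1 i)%N.
Proof.
rewrite aS weight_sum // big_nat_minn /lag subSS subn0; congr (_ + _)%N.
apply: eq_big_nat => i il; rewrite lin_inner; last by lia.
by case: ifP => //; rewrite muln0.
Qed.

Lemma cyc_weight n : b n.+1 = (\sum_(1 <= i < l.+1) weight i * (i * lag a n.+1 i))%N.
Proof.
rewrite bS weight_sum // big_nat_minn /lag subSS subn0 mul1n; congr (_ + _)%N.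
apply: eq_big_nat => i il; rewrite lin_inner; last by lia.
by case: ifP => //; rewrite ?muln0 // mulnCA.
Qed.

Lemma cyc_catalan n : (0 < n <= l)%N -> b n = (n.+1 * catalan n)%N.
Proof.
case: n => // n /= nl; rewrite bS lin_catalan; last by lia.
have -> : minn n.+1 l = n.+1 by lia.
have -> : (\sum_(1 <= m < n.+2) m * (a (m - 2) * a (n.+1 - m)) =
    \sum_(i < n.+1) i.+1 * (catalan i * catalan (n.+1 - i)))%N.
  rewrite big_add1 big_mkord; apply: eq_bigr => -[i /= iS] _.
  rewrite lin_inner ?lin_catalan; [|lia|lia].
  by congr (_ * (catalan _ * catalan _))%N; lia.
(* The sum is the weighted Segner sum without its last term [i = n.+1]. *)
have := segner_sum_weighted n.+1; rewrite segner_catalan big_ord_recr /= subnn catalan0 muln1.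
have := catalanS n.+1; set R := (\sum_(i < _) _)%N; lia.
Qed.

(** [b] is the convolution of [i * weight i] with [a]. Since [i <= l < n], the recurrence of [a]
    applies to every [a (n - i)], and exchanging the two sums gives that of [b]. *)
Lemma cyc_rec n : (l < n)%N -> b n = (\sum_(1 <= i < l.+1) weight i * b (n - i))%N.
Proof.
move=> ln; have bE k : (0 < k)%N -> b k = (\sum_(1 <= i < l.+1) weight i * (i * lag a k i))%N.
  by case: k => // k _; exact: cyc_weight.
rewrite bE; last by lia.
transitivity (\sum_(1 <= i < l.+1) \sum_(1 <= j < l.+1)
    weight j * (weight i * (i * lag a (n - i) j)))%N.
  apply: eq_big_nat => i il; rewrite /lag ifT; last by lia.
  have [k nk] : exists k, (n - i = k.+1)%N by exists (n - i).-1; lia.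
  rewrite {1}nk lin_weight -nk !big_distrr; apply: eq_bigr => j _ /=.
  by rewrite /lag; ring.
rewrite exchange_big /=; apply: eq_big_nat => j jl.
rewrite bE; last by lia.
rewrite big_distrr; apply: eq_big_nat => i il /=.
congr (_ * (_ * (_ * _)))%N; rewrite /lag.
have -> : (j <= n - i)%N = (i <= n - j)%N by lia.
by case: ifP => // _; congr (a _); lia.
Qed.

End CountRecurrences.

(** * Symmetric functions of the roots *)

Section TruncatedSeries.
Variable L : fieldType.
Implicit Types p q : {poly L}.

Lemma coef_dvdXn p n k : 'X^n %| p -> (k < n)%N -> p`_k = 0.
Proof. by move=> /dvdpP[q ->] kn; rewrite coefMXn kn. Qed.

Lemma size_prod_1subX (s : seq L) :
  (size (\prod_(z <- s) (1 - z *: 'X : {poly L}))%R <= (size s).+1)%N.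
Proof.
elim: s => [|z t IHt]; first by rewrite big_nil size_poly1.
rewrite big_cons /=; apply: leq_trans (size_polyMleq _ _) _.
have h : (size (1 - z *: 'X : {poly L})%R <= 2)%N.
  apply: leq_trans (size_polyD _ _) _; rewrite geq_max size_poly1 size_polyN.
  by apply: leq_trans (size_scale_leq _ _) _; rewrite size_polyX.
by rewrite -subn1 leq_subLR; apply: leq_trans (leq_add h IHt) _.
Qed.

(** Reversing the coefficients turns each factor ['X - z%:P] into [1 - z *: 'X]. *)
Lemma coef_rev_prod (s : seq L) k : (k <= size s)%N ->
  (\prod_(z <- s) (1 - z *: 'X))`_k = (\prod_(z <- s) ('X - z%:P))`_(size s - k).
Proof.
elim: s k => [|z s IHs] k; first by rewrite leqn0 => /eqP ->; rewrite !big_nil.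
move=> ks; rewrite !big_cons !mulrBl mul1r -scalerAl !coefB coefZ !coefXM coefCM /=.
case: k ks => [_|k ks] /=.
  rewrite subn0 /= IHs // subn0 mulr0 subr0.
  have -> : (\prod_(z0 <- s) ('X - z0%:P))`_(size s).+1 = 0 :> L.
    by apply: nth_default; rewrite size_prod_XsubC.
  by rewrite mulr0 subr0.
rewrite subSS [X in _ - _ * X]IHs //; congr (_ - _).
case: eqP => sk; last by rewrite IHs; [congr (_`_ _); lia | lia].
by apply: nth_default; apply: leq_trans (size_prod_1subX s) _; lia.
Qed.

Section Roots.
Variables (l : nat) (xi : 'I_l -> L).
Hypothesis l_gt0 : (0 < l)%N.
Hypothesis xiP : char_poly_F L l = \prod_(j < l) ('X - (xi j)%:P).

Definition root_series : {poly L} := \prod_(j < l) (1 - xi j *: 'X).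

Lemma char_poly_F_weight :
  char_poly_F L l = 'X^l - \sum_(1 <= i < l.+1) (weight i)%:R *: 'X^(l - i).
Proof.
rewrite /char_poly_F (big_ltn (m := 1)) // opprD addrA; congr (_ - _ *: _ - _).
apply: eq_big_nat => i i2.
rewrite /weight; case: eqP => [?|_]; [lia | by rewrite /= addn0].
Qed.

Lemma root_seriesE : root_series = 1 - \sum_(1 <= i < l.+1) (weight i)%:R *: 'X^i.
Proof.
have sz : size (map xi (index_enum 'I_l)) = l.
  by rewrite size_map -[RHS]card_ord cardT enumT.
have rE : root_series = \prod_(z <- map xi (index_enum 'I_l)) (1 - z *: 'X).
  by rewrite big_map.
apply/polyP => k; have [kl|lk] := leqP k l; last first.
  rewrite nth_default; last by rewrite rE (leq_trans (size_prod_1subX _)) ?sz.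
  rewrite coefB coef1 coef_sum big_nat big1 => [|i il].
    by case: k lk => // k _; rewrite subr0.
  by rewrite coefZ coefXn; case: eqP => [?|]; [lia | rewrite mulr0].
have -> : root_series`_k = (char_poly_F L l)`_(l - k).
  by rewrite xiP -(big_map xi xpredT (fun z => 'X - z%:P)) rE coef_rev_prod sz.
rewrite char_poly_F_weight !coefB coef1 coefXn; congr (_%:R - _); first by congr nat_of_bool; lia.
rewrite !coef_sum; apply: eq_big_nat => i il.
by rewrite !coefZ !coefXn; congr (_ * _%:R); congr nat_of_bool; lia.
Qed.

Definition geom n j : {poly L} := \sum_(t < n.+1) (xi j *: 'X) ^+ t.

Lemma geomE n j : (1 - xi j *: 'X) * geom n j = 1 - (xi j *: 'X) ^+ n.+1.
Proof. by rewrite -opprB mulNr -subrX1 opprB. Qed.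

(** The inverse of [root_series] modulo ['X^(n.+1)]; only its coefficients up to [n] are
    meaningful. *)
Definition complete_series n : {poly L} := \prod_(j < l) geom n j.

(** Bounding each exponent by [n] loses no term, as the exponents add up to [n]. *)
Lemma complete_coef n : (complete_series n)`_n =
  \sum_(t : {ffun 'I_l -> 'I_n.+1} | (\sum_(j < l) t j == n)%N)
    \prod_(j < l) xi j ^+ t j.
Proof.
rewrite /complete_series bigA_distr_bigA /= coef_sum [RHS]big_mkcond.
apply: eq_bigr => t _.
have -> : \prod_(j < l) (xi j *: 'X) ^+ t j =
   (\prod_(j < l) xi j ^+ t j) *: 'X^(\sum_(j < l) t j) :> {poly L}.
  under eq_bigr => j _ do rewrite exprZn.
  by rewrite scaler_prod prodrXr.
by rewrite coefZ coefXn eq_sym; case: eqP; rewrite ?mulr1 ?mulr0.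
Qed.

Lemma dvdXn_prod_sub1 (r : seq 'I_l) (F : 'I_l -> {poly L}) n :
  (forall j, 'X^n %| F j - 1) -> 'X^n %| \prod_(j <- r) F j - 1.
Proof.
move=> FP; elim/big_rec: _ => [|j q _ IHq]; first by rewrite subrr dvdp0.
have -> : F j * q - 1 = (F j - 1) * q + (q - 1) by ring.
by apply: dvdp_add => //; rewrite dvdp_mulr ?FP.
Qed.

Lemma geom_sub1 n j : 'X^(n.+1) %| (1 - xi j *: 'X) * geom n j - 1.
Proof.
rewrite geomE addrAC subrr add0r dvdpNr exprZn.
by rewrite -mul_polyC dvdp_mull.
Qed.

Lemma complete_inv n : 'X^(n.+1) %| root_series * complete_series n - 1.
Proof.
rewrite /root_series /complete_series -big_split /=.
by apply: dvdXn_prod_sub1 => j; exact: geom_sub1.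
Qed.

Variable a : nat -> nat.
Hypothesis a0 : a 0 = 1%N.
Hypothesis a_rec : forall n, a n.+1 = (\sum_(1 <= i < l.+1) weight i * lag a n.+1 i)%N.

(** Coefficient [k] of the congruence [complete_inv] is the recurrence of [a], with the same initial
    value. *)
Lemma complete_lin n k : (k <= n)%N -> (complete_series n)`_k = (a k)%:R.
Proof.
elim/ltn_ind: k => k IHk kn.
have := @coef_dvdXn _ _ k (complete_inv n) kn.
rewrite root_seriesE mulrBl mul1r !coefB coef1 mulr_suml coef_sum => /eqP.
rewrite subr_eq0 => /eqP; case: k IHk kn => [|k] IHk kn.
  rewrite big_nat big1 ?subr0 ?a0 // => i il.
  by rewrite -scalerAl coefZ coefXnM ifT ?mulr0 //; lia.
move=> /eqP; rewrite subr_eq add0r => /eqP ->; rewrite a_rec natr_sum.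
apply: eq_big_nat => i il.
rewrite -scalerAl coefZ coefXnM natrM; congr (_ * _); rewrite /lag.
by case: ltnP => // ik; rewrite IHk //; lia.
Qed.

Lemma complete_symmetric n : (a n)%:R =
  \sum_(t : {ffun 'I_l -> 'I_n.+1} | (\sum_(j < l) t j == n)%N)
    \prod_(j < l) xi j ^+ t j.
Proof. by rewrite -complete_coef complete_lin. Qed.

(* The logarithmic derivative of the product of the [1 - xi_j X] generates the power sums. *)
Lemma power_sum_series n (r : seq 'I_l) : 'X^(n.+1) %|
  - ('X * (\prod_(j <- r) (1 - xi j *: 'X))^`()) * (\prod_(j <- r) geom n j)
  - \sum_(j <- r) (geom n j - 1).
Proof.
elim: r => [|j r IHr].
  rewrite !big_nil derivC.
  have -> : - ('X * 0) * 1 - 0 = 0 :> {poly L} by ring.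
  exact: dvdp0.
have DC : 'X^(n.+1) %| \prod_(i <- r) (1 - xi i *: 'X) * (\prod_(i <- r) geom n i) - 1.
  by rewrite -big_split /=; apply: dvdXn_prod_sub1 => i; exact: geom_sub1.
rewrite !big_cons derivM derivB derivC derivZ derivX sub0r.
have g1 := geom_sub1 n j.
move: IHr DC g1; set D := \prod_(i <- r) (1 - _); set C := \prod_(i <- r) _.
set S := \sum_(i <- r) _; set g := geom n j; rewrite -!mul_polyC mulr1.
set x := (xi j)%:P => IHr DC g1.
(* After the product rule three multiples of ['X^(n.+1)] remain: from D C = 1, from the induction
   hypothesis and from (1 - x X) g = 1, both equalities modulo that power. *)
have -> : - ('X * (- x * D + (1 - x * 'X) * D^`())) * (g * C) - (g - 1 + S) =
   x * 'X * g * (D * C - 1) + (- ('X * D^`()) * C - S)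
   + (- 1 - 'X * D^`() * C) * ((1 - x * 'X) * g - 1) by ring.
apply: dvdp_add; last exact: dvdp_mull.
by apply: dvdp_add; [exact: dvdp_mull | exact: IHr].
Qed.

(** The coefficients of - X D' are [i * weight i], and those of 1 / D are the [a k]; their
    convolution is the expression found for b_n. Subtracting 1 from each [geom] drops the constant
    terms, so [n = 0] is left out. *)
Lemma power_sum n : (0 < n)%N ->
  ((\sum_(1 <= i < l.+1) weight i * (i * lag a n i))%N)%:R = \sum_(j < l) xi j ^+ n :> L.
Proof.
move=> n0; have := @coef_dvdXn _ _ n (power_sum_series n (index_enum 'I_l)) (leqnn _).
rewrite coefB => /eqP; rewrite subr_eq0 => /eqP.
have -> : (\sum_(j < l) (geom n j - 1))`_n = \sum_(j < l) xi j ^+ n.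
  rewrite coef_sum; apply: eq_bigr => j _.
  rewrite coefB coef1 eqn0Ngt n0 subr0 /geom coef_sum big_ord_recr /= big1 => [|t _].
    by rewrite add0r exprZn coefZ coefXn eqxx mulr1.
  by rewrite exprZn coefZ coefXn; case: eqP (ltn_ord t) => [<-|]; rewrite ?ltnn ?mulr0.
move=> <-; rewrite -/root_series -/(complete_series n) root_seriesE derivB derivC sub0r mulrN opprK.
have -> : (\sum_(1 <= i < l.+1) (weight i)%:R *: 'X^i)^`() =
    \sum_(1 <= i < l.+1) (weight i)%:R *: ('X^(i.-1) *+ i) :> {poly L}.
  by rewrite (raddf_sum (@deriv L)) /=; apply: eq_bigr => i _; rewrite derivZ derivXn.
rewrite mulr_sumr mulr_suml coef_sum natr_sum.
apply: eq_big_nat => i il.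
rewrite -scalerAr -scalerAl coefZ natrM; congr (_ * _).
rewrite mulrnAr -exprS prednK //; last by lia.
rewrite mulrnAl coefMn coefXnM natrM /lag.
case: ltnP => ik; first by rewrite mulr0 mul0rn.
by rewrite complete_lin ?leq_subr // mulr_natl.
Qed.

End Roots.

End TruncatedSeries.

(** * The two families of Nakayama algebras *)

Section NakayamaCounts.
Variables (K : fieldType) (l : nat).

Lemma linear_source_inj n : injective (@source (linear_quiver n)).
Proof. by move=> x y /(congr1 val) /= xy; apply: val_inj. Qed.

Lemma linear_targetE n (x : arrow (linear_quiver n)) :
  target x = @ordS n (source x) :> 'I_n.
Proof.
apply: val_inj; rewrite /= modn_small //.
exact: linear_target_subproof.
Qed.

Lemma linear_full_arcs n : full_arcs (@source (linear_quiver n)) l = lin_arcs l n.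
Proof.
apply/setP => -[i m]; rewrite [RHS]inE /=; apply/full_arcsP/andP => /= -[m0 mf].
  have [m0' mn] := andP m0; split=> //; rewrite leqNgt; apply/negP => nm.
  (* An arc reaching past the end would need an arrow out of the last vertex, at position
     [(n - i).-1] of the arc. *)
  have i_lt := ltn_ord i; have jm : ((n - i).-1.+1 < m)%N by lia.
  have /existsP[a /eqP /(congr1 val)] := mf _ jm.
  rewrite /= val_vrot modn_small; last by lia.
  by have := ltn_ord a; lia.
split=> [|j jm]; first by rewrite m0; lia.
have jn : (i + j < n.-1)%N by lia.
apply/existsP; exists (Ordinal jn); apply/eqP/val_inj.
by rewrite /= val_vrot modn_small //; lia.
Qed.

Lemma cyclic_full_arcs n : full_arcs (@source (cyclic_quiver n)) l = all_arcs l n.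
Proof.
apply/setP => x; rewrite [RHS]inE; apply/full_arcsP/idP => [[/andP[]]//|x0].
have [xn _] := arc_bounds x; rewrite x0 xn; split=> // j _.
by apply/existsP; exists (vrot x.1 j).
Qed.

Lemma num_A_lin (n : nat) : num_A K l n%:Z = lin_count l n.
Proof.
case: n => [|n]; first by rewrite lin_count0.
rewrite /= (num_semibricks_indep K (@linear_source_inj n.+1) (@linear_targetE n.+1)).
by rewrite linear_full_arcs.
Qed.

Lemma num_B_cyc n : num_B K l n = cyc_count l n.
Proof.
have inj : injective (@source (cyclic_quiver n)) by [].
rewrite /num_B (num_semibricks_indep K inj (tgt := @ordS n) (fun=> erefl)).
by rewrite cyclic_full_arcs.
Qed.

Lemma num_A_lag (n i : nat) : num_A K l (n%:Z - i%:Z) = lag (lin_count l) n i.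
Proof.
rewrite /lag; case: leqP => [le_in|lt_ni]; first by rewrite subzn // num_A_lin.
have -> : n%:Z - i%:Z = Negz (i - n).-1; last by [].
by rewrite NegzE prednK ?subn_gt0 // -subzn ?(ltnW lt_ni) // opprB.
Qed.

Lemma weight_sum_2 (F : nat -> nat) : (0 < l)%N ->
  (\sum_(1 <= i < l.+1) weight i * F i =
   2 * F 1 + \sum_(2 <= i < l.+1) catalan (i - 1) * F i)%N.
Proof.
move=> l0; rewrite weight_sum // big_ltn // addnA mul2n -addnn; congr (_ + _ + _)%N.
by rewrite subnn catalan0 mul1n.
Qed.

End NakayamaCounts.

Theorem theorem3p1 (K : fieldType) (l : nat) (l_ge1 : (1 <= l)%N) :
  (forall n : nat, (1 <= n)%N ->
     finite_set [set S | @semibrick K (nakayama_A K n l) S]%classic /\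
     finite_set [set S | @semibrick K (nakayama_B K n l) S]%classic) /\
  ((forall n : nat, (1 <= n <= l)%N ->
      num_A K l n%:Z = catalan n.+1) /\
   (forall n : nat, (1 <= n)%N ->
      num_A K l n%:Z =
        (2 * num_A K l (n%:Z - 1)%R
         + \sum_(2 <= i < l.+1) catalan (i - 1) * num_A K l (n%:Z - i%:Z)%R)%N)) /\
  ((forall n : nat, (1 <= n <= l)%N ->
      num_B K l n = (n.+1 * catalan n)%N) /\
   (forall n : nat, (l.+1 <= n)%N ->
      num_B K l n =
        (2 * num_B K l (n - 1)
         + \sum_(2 <= i < l.+1) catalan (i - 1) * num_B K l (n - i))%N)) /\
  (forall (R : realType) (xi : 'I_l -> R[i]),
     char_poly_F R[i] l = \prod_(j < l) ('X - (xi j)%:P) ->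
     forall n : nat, (1 <= n)%N ->
       (num_A K l n%:Z)%:R =
         \sum_(t : {ffun 'I_l -> 'I_n.+1} | (\sum_(j < l) t j == n)%N)
           \prod_(j < l) xi j ^+ t j
       /\ (num_B K l n)%:R = \sum_(j < l) xi j ^+ n).
Proof.
pose a := lin_count l; pose b := cyc_count l.
have a0 : a 0 = 1%N := lin_count0 l.
have aS := lin_count_rec l : forall n, a n.+1 = _.
have bS := cyc_count_rec l : forall n, b n.+1 = _.
have a_rec := lin_weight l_ge1 a0 aS.
split.
  move=> n _; split.
    exact: (finite_semibricks K (@linear_source_inj n) (@linear_targetE n)).
  exact: (finite_semibricks K (src := id) (tgt := @ordS n) (@inj_id _) (fun=> erefl)).
split; [split | split; [split |]].
- by move=> n /andP[_ nl]; rewrite num_A_lin; exact: (lin_catalan l_ge1 a0 aS).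
- case=> // n _; rewrite num_A_lin (num_A_lag K l n.+1 1) -/a a_rec weight_sum_2 //.
  by congr (_ + _)%N; apply: eq_bigr => i _; rewrite num_A_lag.
- by move=> n nl; rewrite num_B_cyc; exact: (cyc_catalan l_ge1 a0 aS bS).
- move=> n nl; rewrite num_B_cyc -/b (cyc_rec l_ge1 a0 aS bS) // weight_sum_2 //.
  by rewrite num_B_cyc; congr (_ + _)%N; apply: eq_bigr => i _; rewrite num_B_cyc.
move=> R xi xiP n n0; split.
  by rewrite num_A_lin; exact: (complete_symmetric l_ge1 xiP a0 a_rec).
rewrite num_B_cyc -(power_sum l_ge1 xiP a0 a_rec n0).
by case: n n0 => // n _; rewrite -(cyc_weight l_ge1 a0 aS bS).
Qed.
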